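(* Let $\mathcal S$ and $\mathcal A$ be compact. Let $\pi^m_\theta(a|s)=\sum_{k=1}^N\pi^w_\theta(k|s)\pi^c_\theta(a|s,k)$ be a mixture policy whose components are reparameterized: for $\epsilon\sim p(\cdot)$, $f_\theta(\epsilon;s,k)\sim\pi^c_\theta(\cdot|s,k)$, with $f_\theta(\cdot;s,k)$ invertible with inverse $f^{-1}_\theta(a;s,k)$. Assume $p(s'|s,a)$, $d_0(s)$, $r(s,a)$, $f_\theta(\epsilon;s,k)$, $f^{-1}_\theta(a;s,k)$, $\pi^w_\theta(k|s)$, $\pi^c_\theta(a|s,k)$, $p(\epsilon)$ and their derivatives are continuous in $s,a,s',\theta,\epsilon$. Then $$\nabla_\theta J_0(\pi^m_\theta)=\mathbb{E}_{s\sim d_{\pi^m_\theta},\,k\sim\pi^w_\theta(\cdot|s),\,\epsilon\sim p}\Big[Q_{\pi^m_\theta}(s,f_\theta(\epsilon;s,k))\nabla_\theta\log\pi^w_\theta(k|s)+\nabla_\theta f_\theta(\epsilon;s,k)\,\nabla_aQ_{\pi^m_\theta}(s,a)\big|_{a=f_\theta(\epsilon;s,k)}\Big].$$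
   Context: MDP $\langle\mathcal S,\mathcal A,p,d_0,r,\gamma\rangle$ with continuous actions, deterministic bounded reward, discount $\gamma$. Expected return $J_0(\pi)=\mathbb{E}_\pi[\sum_{t\ge0}\gamma^tr(S_t,A_t)]$ with $S_0\sim d_0$. $Q_\pi(s,a)=\mathbb{E}_\pi[\sum_{t\ge0}\gamma^tr(S_t,A_t)\mid S_0=s,A_0=a]$ is the (unregularized) action-value function. Discounted occupancy measure $d_\pi(s)=\mathbb{E}_\pi[\sum_{t\ge0}\gamma^t\mathbb{I}(S_t=s)]$. $\pi^w_\theta(\cdot|s)$ is a distribution on $\{1,\dots,N\}$. *)

(* Defs.v *)
From mathcomp Require Import all_boot all_order all_algebra.
From mathcomp Require Import all_classical all_reals all_analysis.
Import numFieldNormedType.Exports.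

Set Implicit Arguments.
Unset Strict Implicit.
Unset Printing Implicit Defensive.
Import Order.TTheory GRing.Theory Num.Theory.
Local Open Scope ring_scope.
Local Open Scope classical_set_scope.

(* Lebesgue integral on R^n = 'rV[R]_n, realised as the iterated       *)
(* one-dimensional Lebesgue integral (Fubini), since mathcomp-analysis *)
(* provides Lebesgue measure only on R.                                *)
Fixpoint iint (R : realType) (n : nat) : ('rV[R]_n -> R) -> R :=
  match n return ('rV[R]_n -> R) -> R with
  | 0 => fun g => g 0
  | n'.+1 => fun g =>
      Rintegral (@lebesgue_measure R) setT
        (fun x : R => iint (fun y : 'rV[R]_n' => g (row_mx (x%:M : 'rV[R]_1) y)))
  end.

Definition integral_on (R : realType) (n : nat) (D : set 'rV[R]_n)
    (g : 'rV[R]_n -> R) : R :=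
  iint (fun x => \1_D x * g x).

Definition rseries (R : realType) (u : nat -> R) : R := limn (series u).

Definition C1 (R : realType) (V W : normedModType R) (g : V -> W) : Prop :=
  (forall x, differentiable g x) /\ (forall v, continuous (fun x => 'd g x v)).

(* MDP quantities for a stationary policy with density                *)
(* pol s a = pi(a|s) on A, transition density p s a s' on S,          *)
(* initial density d0 on S, reward r, discount gamma.                 *)
Section MDP.
Variables (R : realType) (n m : nat).
Variables (S : set 'rV[R]_n) (A : set 'rV[R]_m).
Variable p : 'rV[R]_n -> 'rV[R]_m -> 'rV[R]_n -> R.
Variable d0 : 'rV[R]_n -> R.
Variable r : 'rV[R]_n -> 'rV[R]_m -> R.
Variable gamma : R.
Variable pol : 'rV[R]_n -> 'rV[R]_m -> R.

Fixpoint state_dens (t : nat) : 'rV[R]_n -> R :=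
  match t with
  | 0 => d0
  | t'.+1 => fun s' =>
      integral_on S (fun s => state_dens t' s *
        integral_on A (fun a => pol s a * p s a s'))
  end.

(* one-step conditional expectation operator on functions of (s,a):
   (P g)(s,a) = E[ g(S_1, A_1) | S_0 = s, A_0 = a ] *)
Definition Pop (g : 'rV[R]_n -> 'rV[R]_m -> R) : 'rV[R]_n -> 'rV[R]_m -> R :=
  fun s a => integral_on S (fun s' => p s a s' *
               integral_on A (fun a' => pol s' a' * g s' a')).

(* Q_pi(s,a) = sum_t gamma^t E[r(S_t,A_t) | S_0=s, A_0=a] *)
Definition Qfun (s : 'rV[R]_n) (a : 'rV[R]_m) : R :=
  rseries (fun t => gamma ^+ t * iter t Pop r s a).

Definition occupancy (s : 'rV[R]_n) : R :=
  rseries (fun t => gamma ^+ t * state_dens t s).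

(* J_0(pi) = E[ sum_t gamma^t r(S_t,A_t) ] = sum_t gamma^t E[r(S_t,A_t)] *)
Definition J0 : R :=
  rseries (fun t => gamma ^+ t *
    integral_on S (fun s => state_dens t s *
      integral_on A (fun a => pol s a * r s a))).

End MDP.

Definition mix_pol (R : realType) (n m d N : nat)
    (piw : 'rV[R]_d -> 'rV[R]_n -> 'I_N -> R)
    (pic : 'rV[R]_d -> 'rV[R]_n -> 'I_N -> 'rV[R]_m -> R)
    (theta : 'rV[R]_d) : 'rV[R]_n -> 'rV[R]_m -> R :=
  fun s a => \sum_(k < N) piw theta s k * pic theta s k a.

(* Main.v *)
From HB Require Import structures.
Require Import Defs.
From mathcomp Require Import all_boot all_order all_algebra.
From mathcomp Require Import all_classical all_reals all_analysis.
From mathcomp Require Import measurable_realfun ring lra.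
Import numFieldNormedType.Exports.
Set Implicit Arguments.
Unset Strict Implicit.
Unset Printing Implicit Defensive.
Import Order.TTheory GRing.Theory Num.Theory.
Local Open Scope ring_scope.
Local Open Scope classical_set_scope.

(* Only positivity and linearity of the integrals on continuous functions matter.
   A continuous function times the indicator of a compact set is a dominated limit
   of compactly supported continuous functions, so [integral_on D] is a positive
   linear functional; continuity in a parameter, Fubini and differentiation under
   the integral then follow from uniform estimates on compact sets.

   With [Pi_th] the average over actions, the performance difference lemma gives
     J(th') - J(th) = sum_t gamma^t E_{S_t under th'} [(Pi_th' - Pi_th) Q_th].
   The integrand is O(|th' - th|), and replacing the law of [S_t] under [th'] by the
   one under [th] costs only o(|th' - th|): this is the performance difference lemma
   again, applied to the integrand as a reward. Hence [J] has the derivative of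
   [th' |-> E_{s ~ d_th} [(Pi_th' Q_th) s]], in which neither [Q] nor the occupancy
   depends on [th']. Reparameterizing this average before differentiating produces
   the two terms of the formula. The noise space is the image of [A] under [finv],
   hence compact; where a mixture weight vanishes it is minimal, so its gradient
   vanishes too and the junk value of [ln] at [0] is harmless. *)

(** Two features of the setting shape the proof. Densities are nonnegative and of mass one only over
    [S] and [A], while the given functions are differentiable on the whole spaces, and a
    neighbourhood of a point of [A] may leave [A]. So [Qfun] and [occupancy] have to be continuous
    everywhere, although the iterates of [Pop] obey a sup-norm bound only over [S] and [A];
    elsewhere the bounds uniform in time are merely local. Moreover [C1] makes the differential
    continuous separately in each direction, so uniform estimates go through the basis directions,
    of which there are finitely many.

    No infinite sum is differentiated. The action derivative of [Qfun] comes from the Bellman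
    equation, which leaves only [r] and [p] to differentiate, and the parameter derivative of [J0]
    from comparison with an objective frozen at [theta]. The remainder is controlled by a product:
    the Lipschitz bound on the integrand times the uniform distance of two policies, which tends to
    0 by continuity and compactness. *)

Section continuous_real_valued.
Variables (R : realType) (T : topologicalType).
Implicit Types f g : T -> R.

Lemma cts_add f g : continuous f -> continuous g -> continuous (fun x => f x + g x).
Proof. by move=> cf cg x; apply: cvgD; [exact: cf|exact: cg]. Qed.

Lemma cts_sub f g : continuous f -> continuous g -> continuous (fun x => f x - g x).
Proof. by move=> cf cg x; apply: cvgB; [exact: cf|exact: cg]. Qed.

Lemma cts_mul f g : continuous f -> continuous g -> continuous (fun x => f x * g x).
Proof. by move=> cf cg x; apply: cvgM; [exact: cf|exact: cg]. Qed.

Lemma cts_norm f : continuous f -> continuous (fun x => `|f x|).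
Proof. by move=> cf x; apply: cvg_norm; exact: cf. Qed.

Lemma cts_max f g : continuous f -> continuous g ->
  continuous (fun x => Num.max (f x) (g x)).
Proof. by move=> cf cg x; apply: continuous_max; [exact: cf|exact: cg]. Qed.

Lemma cts_min f g : continuous f -> continuous g ->
  continuous (fun x => Num.min (f x) (g x)).
Proof. by move=> cf cg x; apply: continuous_min; [exact: cf|exact: cg]. Qed.

Lemma cts_cst (c : R) : continuous (fun _ : T => c).
Proof. exact: cst_continuous. Qed.

Lemma cts_sum N (f : 'I_N -> T -> R) : (forall k, continuous (f k)) ->
  continuous (fun x => \sum_k f k x).
Proof.
move=> cf; elim: N f cf => [|N IH] f cf.
  by under eq_fun do rewrite big_ord0; exact: cts_cst.
under eq_fun do rewrite big_ord_recl.
by apply: cts_add; [exact: cf|exact: IH].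
Qed.

End continuous_real_valued.

Lemma cts_comp (T U V : topologicalType) (f : T -> U) (g : U -> V) :
  continuous f -> continuous g -> continuous (fun x => g (f x)).
Proof. by move=> cf cg x; apply: continuous_comp; [exact: cf|exact: cg]. Qed.

Lemma cts_pair (T U V : topologicalType) (f : T -> U) (g : T -> V) :
  continuous f -> continuous g -> continuous (fun x => (f x, g x)).
Proof. by move=> cf cg x; apply: cvg_pair; [exact: cf|exact: cg]. Qed.

Lemma cts_fst (T U V : topologicalType) (f : T -> U * V) :
  continuous f -> continuous (fun x => (f x).1).
Proof. by move=> cf x; apply: (cvg_comp _ _ (cf x)); exact: cvg_fst. Qed.

Lemma cts_snd (T U V : topologicalType) (f : T -> U * V) :
  continuous f -> continuous (fun x => (f x).2).
Proof. by move=> cf x; apply: (cvg_comp _ _ (cf x)); exact: cvg_snd. Qed.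

Lemma cts_id (T : topologicalType) : continuous (fun x : T => x).
Proof. by move=> x; exact: cvg_id. Qed.

(** * Iterated integrals of compactly supported functions *)

Section Rintegral_bounded_support.
Variable R : realType.
Notation mu := (@lebesgue_measure R).

Lemma integrable_bounded_support (F : R -> R) (M B : R) :
  measurable_fun setT F -> (forall x, `|F x| <= M) ->
  (forall x, B < `|x| -> F x = 0) -> mu.-integrable setT (EFin \o F).
Proof.
move=> mF FM FB.
have -> : EFin \o F = (EFin \o F) \_ (`[- B, B]%classic : set R).
  apply/funext => x /=; rewrite /patch; case: ifPn => // /negP xB.
  rewrite /= FB//; rewrite ltNge; apply/negP; rewrite ler_norml => xB'.
  by apply: xB; rewrite inE /= in_itv.
apply/(integrable_mkcond _ _).1 => //.
apply: measurable_bounded_integrable => //=.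
- rewrite lebesgue_measure_itv/=; case: ifP => // _.
  by rewrite -EFinB ltry.
- exact: measurable_funTS.
- exists M; split; first exact: num_real.
  by move=> y My x _ /=; exact: le_trans (FM x) (ltW My).
Qed.

Lemma Rintegral_cvg_bounded_support (F_ : nat -> R -> R) (F : R -> R) (M B : R) :
  (forall k, measurable_fun setT (F_ k)) -> (forall k x, `|F_ k x| <= M) ->
  (forall k x, B < `|x| -> F_ k x = 0) ->
  (forall x, F_ ^~ x @ \oo --> F x) ->
  Rintegral mu setT (F_ k) @[k --> \oo] --> Rintegral mu setT F.
Proof.
move=> mF_ F_M F_B F_F.
have mF : measurable_fun setT F by apply: measurable_fun_cvg mF_ _.
have FM x : `|F x| <= M.
  have /cvg_lim <- // : `|F_ k x| @[k --> \oo] --> `|F x| by exact: cvg_norm.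
  apply: limr_le; first by apply: is_cvg_norm; apply/cvg_ex; exists (F x).
  by near=> k; exact: F_M.
have M0 : 0 <= M by exact: le_trans (FM 0).
have FB x : B < `|x| -> F x = 0.
  move=> Bx; move: (F_F x).
  have -> : F_ ^~ x = cst 0 by apply/funext => k; exact: F_B.
  by move/cvg_lim => <- //; rewrite lim_cst.
(* The dominating function: the common bound on the common support. *)
pose G (x : R) := M * \1_(`[- B, B]%classic : set R) x.
have ig : mu.-integrable setT (EFin \o G).
  apply: (@integrable_bounded_support _ M B).
  - by apply: measurable_funM => //; exact: measurable_indic.
  - move=> x; rewrite /G normrM ger0_norm// ler_piMr// indicE.
    by case: (_ \in _); rewrite ?normr0 ?normr1.
  - move=> x Bx; rewrite /G indicE memNset ?mulr0//= in_itv/= -ler_norml.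
    by apply/negP; rewrite -ltNge.
have mEF_ k : measurable_fun setT (fun x => (F_ k x)%:E).
  exact/measurable_EFinP.
have mEF : measurable_fun setT (EFin \o F) by exact/measurable_EFinP.
have cEF : {ae mu, forall x, setT x -> (F_ k x)%:E @[k --> \oo] --> (EFin \o F) x}.
  apply: aeW => x _; apply: cvg_EFin; [exact: nearW|exact: F_F].
have bEF : {ae mu, forall x k, setT x -> (`|(F_ k x)%:E| <= (EFin \o G) x)%E}.
  apply: aeW => x k _ /=; rewrite lee_fin /G indicE; case: (ltP B `|x|) => Bx.
    by rewrite F_B// normr0 mulr_ge0.
  by rewrite mem_set ?mulr1//= in_itv/= -ler_norml.
have [_ _] := @dominated_convergence _ _ _ mu setT measurableT _ _ _ mEF_ mEF cEF ig bEF.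
move=> h; rewrite /Rintegral; apply: fine_cvg.
by rewrite fineK//; apply: integrable_fin_num => //;
  exact: integrable_bounded_support FB.
Unshelve. all: by end_near. Qed.

End Rintegral_bounded_support.

Section iint_bounded_support.
Variable R : realType.
Notation mu := (@lebesgue_measure R).

Lemma ler_mx_entry m n (x : 'M[R]_(m, n)) i j : `|x i j| <= `|x|.
Proof.
rewrite [leRHS]/Num.norm/= mx_normrE.
exact: (@le_bigmax _ _ _ _ (fun ij : 'I_m * 'I_n => `|x ij.1 ij.2|) (i, j)).
Qed.

Lemma ler_mx_normP m n (x : 'M[R]_(m, n)) (c : R) : 0 <= c ->
  (forall i j, `|x i j| <= c) -> `|x| <= c.
Proof.
move=> c0 xc; rewrite [leLHS]/Num.norm/= mx_normrE.
by apply: bigmax_le => // ij _; exact: xc.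
Qed.

(** The splitting of coordinates along which [iint] recurses, named so that norms and limits can be
    stated about it. *)
Definition vcons n (x : R) (y : 'rV[R]_n) : 'rV[R]_n.+1 :=
  row_mx (x%:M : 'rV[R]_1) y.

Lemma vconsB n x x' (y y' : 'rV[R]_n) :
  vcons x y - vcons x' y' = vcons (x - x') (y - y').
Proof.
by apply/rowP => i; rewrite !mxE; case: splitP => k _; rewrite !mxE ?mulrnBl.
Qed.

Lemma norm_vcons_le n x (y : 'rV[R]_n) (c : R) :
  `|x| <= c -> `|y| <= c -> `|vcons x y| <= c.
Proof.
move=> xc yc; apply: ler_mx_normP => [|i j]; first exact: le_trans xc.
rewrite /vcons mxE; case: splitP => k _.
  by rewrite !ord1 mxE eqxx mulr1n.
by rewrite (le_trans _ yc)// ler_mx_entry.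
Qed.

Lemma norm_vconsl n x (y : 'rV[R]_n) : `|x| <= `|vcons x y|.
Proof.
rewrite -[in leLHS](_ : vcons x y ord0 (lshift n (ord0 : 'I_1)) = x) ?ler_mx_entry//.
by apply: (etrans (row_mxEl (x%:M : 'rV[R]_1) y _ _)); rewrite mxE eqxx mulr1n.
Qed.

Lemma norm_vconsr n x (y : 'rV[R]_n) : `|y| <= `|vcons x y|.
Proof.
apply: ler_mx_normP => // i j.
rewrite -[y i j](_ : vcons x y i (rshift 1 j) = _) ?ler_mx_entry//.
exact: (row_mxEr (x%:M : 'rV[R]_1) y).
Qed.

Lemma continuous_vconsr n x : continuous (@vcons n x).
Proof.
move=> y; apply/(@cvgrPdist_le _ _ _ (nbhs y)) => e e0; near=> z.
by rewrite vconsB subrr norm_vcons_le ?normr0 ?(ltW e0)//; exact/ltW.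
Unshelve. all: by end_near. Qed.

Lemma cvg_vconsl n (u : nat -> R) x (y : 'rV[R]_n) :
  u @ \oo --> x -> vcons (u k) y @[k --> \oo] --> vcons x y.
Proof.
move=> ux; apply/cvgrPdist_le => e e0; near=> z.
rewrite vconsB subrr norm_vcons_le ?normr0 ?(ltW e0)//.
by near: z; exact: cvgr_dist_le.
Unshelve. all: by end_near. Qed.

(** The constants are explicit because dominated convergence needs a whole sequence to share them;
    fixing the first coordinate preserves both. *)
Definition bounded_support n (M B : R) (g : 'rV[R]_n -> R) :=
  [/\ continuous g, forall x, `|g x| <= M & forall x, B < `|x| -> g x = 0].

Lemma bounded_support_vcons n M B (g : 'rV[R]_n.+1 -> R) x :
  bounded_support M B g -> bounded_support M B (fun y => g (vcons x y)).
Proof.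
move=> [cg gM gB]; split => // [y|y By].
  by apply: continuous_comp; [exact: continuous_vconsr|exact: cg].
by rewrite gB// (lt_le_trans By)// norm_vconsr.
Qed.

(** The bound 0 lets the estimate on [iint] conclude that the outer integrand vanishes beyond
    [B]. *)
Lemma bounded_support0_vcons n M B (g : 'rV[R]_n.+1 -> R) x :
  bounded_support M B g -> B < `|x| -> bounded_support 0 B (fun y => g (vcons x y)).
Proof.
move=> [_ _ gB] Bx.
have -> : (fun y => g (vcons x y)) = cst 0.
  by apply/funext => y; rewrite gB// (lt_le_trans Bx)// norm_vconsl.
by split=> [|y|//]; [exact: cst_continuous|rewrite normr0].
Qed.

(* The two parts are proved together: domination of the outer integrands needs the
   bound, and their measurability comes from the convergence statement through
   sequential continuity. *)
Lemma iint_bound_cvg n (B : R) :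
  (exists2 C : R, 0 <= C & forall M (g : 'rV[R]_n -> R),
     bounded_support M B g -> `|iint g| <= C * M) /\
  (forall M (g_ : nat -> 'rV[R]_n -> R) (g : 'rV[R]_n -> R),
     (forall k, bounded_support M B (g_ k)) -> (forall x, g_ ^~ x @ \oo --> g x) ->
     iint (g_ k) @[k --> \oo] --> iint g).
Proof.
elim: n => [|n [[C C0 IHb] IHc]].
  split; first by exists 1 => // M g [_ gM _] /=; rewrite mul1r.
  by move=> M g_ g _ gg /=; exact: gg.
have cF M (g : 'rV[R]_n.+1 -> R) : bounded_support M B g ->
    continuous (fun x => iint (fun y => g (vcons x y))).
  move=> bg x; apply/(@cvg_nbhsP _ R^o) => u ux.
  apply: (IHc M) => [k|y]; first exact: bounded_support_vcons.
  have [cg _ _] := bg; apply: continuous_cvg; first exact: cg.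
  exact: cvg_vconsl.
have mF M (g : 'rV[R]_n.+1 -> R) : bounded_support M B g ->
    measurable_fun setT (fun x => iint (fun y => g (vcons x y))).
  by move=> /cF cFg; exact: continuous_measurable_fun.
have FM M (g : 'rV[R]_n.+1 -> R) : bounded_support M B g ->
    forall x, `|iint (fun y => g (vcons x y))| <= C * M.
  by move=> bg x; apply: IHb; exact: bounded_support_vcons.
have FB M (g : 'rV[R]_n.+1 -> R) : bounded_support M B g ->
    forall x, B < `|x| -> iint (fun y => g (vcons x y)) = 0.
  move=> bg x Bx; apply/eqP; rewrite -normr_le0 -(mulr0 C).
  by apply: IHb; exact: bounded_support0_vcons bg Bx.
split; last first.
  move=> M g_ g bg gg /=.
  apply: (@Rintegral_cvg_bounded_support _ _ _ (C * M) B) => [k|k x|k x Bx|x].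
  - exact: mF (bg k).
  - exact: FM.
  - exact: FB (bg k) _ Bx.
  - by apply: (IHc M) => [k|y]; [exact: bounded_support_vcons|exact: gg].
(* Slices contribute at most [C * M] over [[- B, B]] and nothing outside, so the new constant is [C]
   times the length of this interval. *)
pose box : R -> R := \1_(`[- B, B]%classic : set R).
have box0 x : 0 <= box x by rewrite /box indicE ler0n.
have box1 x : `|x| <= B -> box x = 1.
  by move=> xB; rewrite /box indicE mem_set//= in_itv/= -ler_norml.
have mbox : measurable_fun setT box by exact: measurable_indic.
have ibox : mu.-integrable setT (EFin \o box).
  apply: (@integrable_bounded_support _ box 1 B) => //.
  - by move=> x; rewrite /box indicE; case: (_ \in _); rewrite ?normr0 ?normr1.
  - move=> x Bx; rewrite /box indicE memNset//= in_itv/= -ler_norml.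
    by apply/negP; rewrite -ltNge.
exists (C * Rintegral mu setT box).
  by apply: mulr_ge0 => //; apply: Rintegral_ge0 => x _; exact: box0.
move=> M g bg /=.
have iF : mu.-integrable setT (EFin \o (fun x => iint (fun y => g (vcons x y)))).
  by apply: integrable_bounded_support (FM _ _ bg) (FB _ _ bg); exact: mF bg.
apply: (le_trans (le_normr_Rintegral measurableT iF)).
rewrite mulrAC -RintegralZl//.
apply: le_Rintegral => //.
- apply: (@integrable_bounded_support _ _ (C * M) B) => [|x|x Bx].
  + by apply: measurableT_comp => //; exact: mF bg.
  + by rewrite normr_id; exact: FM.
  + by rewrite (FB _ _ bg)// normr0.
- have := integrableZl measurableT (C * M) ibox.
  by under eq_fun do rewrite -EFinM.
- move=> x _; case: (ltP B `|x|) => Bx.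
    rewrite (FB _ _ bg)// normr0 mulr_ge0//.
    by rewrite (le_trans _ (FM _ _ bg x)).
  by rewrite -[leRHS]/(C * M * box x) box1// mulr1; exact: FM.
Qed.

Lemma iint_cvg n (M B : R) (g_ : nat -> 'rV[R]_n -> R) (g : 'rV[R]_n -> R) :
  (forall k, bounded_support M B (g_ k)) -> (forall x, g_ ^~ x @ \oo --> g x) ->
  iint (g_ k) @[k --> \oo] --> iint g.
Proof. exact: (iint_bound_cvg n B).2. Qed.

Lemma iint_ge0 n (g : 'rV[R]_n -> R) : (forall x, 0 <= g x) -> 0 <= iint g.
Proof.
elim: n g => [|n IH] g g0 /=; first exact: g0.
by apply: Rintegral_ge0 => x _; exact: IH.
Qed.

Lemma integrable_iint_vcons n M B (g : 'rV[R]_n.+1 -> R) : bounded_support M B g ->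
  mu.-integrable setT (EFin \o (fun x => iint (fun y => g (vcons x y)))).
Proof.
move=> bg; have [[C C0 bC] cC] := iint_bound_cvg n B.
apply: (@integrable_bounded_support _ _ (C * M) B) => [|x|x Bx].
- apply: continuous_measurable_fun => x; apply/(@cvg_nbhsP _ R^o) => u ux.
  apply: (cC M) => [k|y]; first exact: bounded_support_vcons.
  have [cg _ _] := bg; apply: continuous_cvg; first exact: cg.
  exact: cvg_vconsl.
- by apply: bC; exact: bounded_support_vcons.
- apply/eqP; rewrite -normr_le0 -(mulr0 C).
  by apply: bC; exact: bounded_support0_vcons bg Bx.
Qed.

Lemma iint_lin n a M B (g h : 'rV[R]_n -> R) :
  bounded_support M B g -> bounded_support M B h ->
  iint (fun x => a * g x + h x) = a * iint g + iint h.
Proof.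
elim: n g h => [//|n IH] g h bg bh /=.
have ig := integrable_iint_vcons bg; have ih := integrable_iint_vcons bh.
rewrite -RintegralZl// -RintegralD//; last first.
  have := integrableZl measurableT a ig.
  by under eq_fun do rewrite -EFinM.
apply: eq_Rintegral => x _.
by apply: IH; exact: (bounded_support_vcons x).
Qed.

End iint_bounded_support.

(** * Positive linear functionals *)

(** A finite measure on [D], seen only through functions continuous on all of [X]: no measurability
    or integrability condition ever arises. Compactness of [D] is included because every uniform
    estimate rests on it. *)
Definition pos_functional (R : realType) (X : topologicalType) (D : set X)
    (I : (X -> R) -> R) : Prop :=
  [/\ compact D,
      forall g h : X -> R, (forall x, D x -> g x = h x) -> I g = I h,
      forall (a : R) (g h : X -> R), continuous g -> continuous h ->
        I (fun x => a * g x + h x) = a * I g + I h &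
      forall g : X -> R, continuous g -> (forall x, D x -> 0 <= g x) -> 0 <= I g].

Lemma compact_norm_bound (R : realType) (X : topologicalType) (D : set X)
    (g : X -> R) : compact D -> continuous g ->
  exists2 M : R, 0 <= M & forall x, D x -> `|g x| <= M.
Proof.
move=> cD cg.
have /compact_bounded[M [_ bM]] : compact (g @` D).
  by apply: continuous_compact => //; exact: continuous_subspaceT.
exists (`|M| + 1) => [|x Dx]; first by rewrite addr_ge0.
apply: bM; last by exists x.
by rewrite (le_lt_trans (ler_norm _))// ltrDl.
Qed.

(** * The integral over a compact set as a positive functional *)

Section integral_on_compact.
Variables (R : realType) (n : nat) (D : set 'rV[R]_n).
Hypotheses (cD : compact D) (D0 : D !=set0).

Let dset (x : 'rV[R]_n) := [set `|x - y| | y in D].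
Let dist (x : 'rV[R]_n) : R := inf (dset x).

Let dset_inf x : has_inf (dset x).
Proof.
split; first by case: D0 => y Dy; exists `|x - y|; exists y.
by exists 0 => _ [y _ <-].
Qed.

Let dist_ge0 x : 0 <= dist x.
Proof. by apply: lb_le_inf; [case: (dset_inf x)|move=> _ [y _ <-]]. Qed.

Let dist_le x y : D y -> dist x <= `|x - y|.
Proof. by move=> Dy; apply: ge_inf; [case: (dset_inf x)|exists y]. Qed.

Let dist_approx x (e : R) : 0 < e -> exists2 y, D y & `|x - y| < dist x + e.
Proof. by move=> e0; have [_ [y Dy <-] h] := inf_adherent e0 (dset_inf x); exists y. Qed.

Let dist_lip x x' : dist x <= dist x' + `|x - x'|.
Proof.
apply/ler_addgt0Pr => e e0; have [y Dy yx'] := dist_approx x' e0.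
apply: (le_trans (dist_le x Dy)); rewrite addrAC.
rewrite -(subrKA x' x); apply: (le_trans (ler_normD _ _)).
by rewrite [leRHS]addrC lerD2l ltW.
Qed.

Let dist_continuous : continuous dist.
Proof.
move=> x; apply/(@cvgrPdist_le _ _ _ (nbhs x)) => e e0.
near=> z; have xz : `|x - z| <= e.
  by near: z; apply: (@cvgr_dist_le _ _ _ (nbhs x) _ id) => //; exact: cvg_id.
rewrite ler_norml; apply/andP; split.
  by rewrite lerNl opprB lerBlDl (le_trans (dist_lip z x))// lerD2l distrC.
by rewrite lerBlDl (le_trans (dist_lip x z))// lerD2l.
Unshelve. all: by end_near. Qed.

Let dist_eq0 x : D x -> dist x = 0.
Proof.
move=> Dx; apply/eqP; rewrite eq_le dist_ge0 andbT.
by rewrite (le_trans (dist_le x Dx))// subrr normr0.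
Qed.

Let dist_gt0 x : ~ D x -> 0 < dist x.
Proof.
move=> nDx; rewrite lt_neqAle dist_ge0 andbT; apply/eqP => d0; apply: nDx.
have clD : closed D by apply: compact_closed => //; exact: norm_hausdorff.
apply: clD => U /nbhs_ballP[e /= e0 xU].
have [y Dy] := dist_approx x e0; rewrite -d0 add0r => xy.
by exists y; split => //; apply: xU; rewrite -ball_normE.
Qed.

(** Decreases to the indicator of the closed set [D] and vanishes at distance [1 / (k + 1)] or more
    from it, so all bumps share one bounded support. *)
Let bump k (x : 'rV[R]_n) : R := Num.max 0 (1 - k.+1%:R * dist x).

Let bump_ge0 k x : 0 <= bump k x.
Proof. by rewrite le_max lexx. Qed.

Let bump_le1 k x : bump k x <= 1.
Proof. by rewrite ge_max ler01 gerBl mulr_ge0. Qed.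

Let bump_continuous k : continuous (bump k).
Proof.
apply: cts_max; first exact: cts_cst.
apply: cts_sub; first exact: cts_cst.
by apply: cts_mul; [exact: cts_cst|exact: dist_continuous].
Qed.

Let bump_cvg x : bump k x @[k --> \oo] --> (\1_D x : R).
Proof.
rewrite indicE; have [/set_mem Dx|/negP nDx] := boolP (x \in D).
  rewrite (_ : bump ^~ x = cst 1); first exact: cvg_cst.
  by apply/funext => k; rewrite /bump dist_eq0// mulr0 subr0 max_r.
have d0 : 0 < dist x by apply: dist_gt0 => Dx; apply: nDx; exact: mem_set.
apply: cvg_near_cst; near=> k.
rewrite /bump max_l// subr_le0 -ler_pdivrMr// mul1r.
apply: (@le_trans _ _ k%:R); last by rewrite ler_nat.
by near: k; exact: nbhs_infty_ger.
Unshelve. all: by end_near. Qed.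

Let bump_support : exists B : R, forall k (x : 'rV[R]_n), B < `|x| -> bump k x = 0.
Proof.
have /compact_bounded[M [_ bM]] := cD.
(* [|M| + 1] bounds [D]. A point of norm larger by 2 is at distance at least 1 from [D], where even
   the widest bump, that of [k = 0], vanishes. *)
exists (`|M| + 1 + 2) => k x Bx; rewrite /bump max_l// subr_le0.
have d1 : 1 <= dist x.
  rewrite leNgt; apply/negP => d1; have [y Dy xy] := dist_approx x (@ltr01 R).
  move: Bx; apply/negP; rewrite -leNgt -(subrK y x) (le_trans (ler_normD _ _))//.
  rewrite addrC lerD//; last by rewrite (le_trans (ltW xy))//; lra.
  by apply: bM => //; rewrite (le_lt_trans (ler_norm _))// ltrDl.
by apply: (le_trans d1); rewrite ler_peMl// ler1n.
Qed.

Let integral_on_ext g h : (forall x, D x -> g x = h x) ->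
  integral_on D g = integral_on D h.
Proof.
move=> gh; congr iint; apply/funext => x; rewrite indicE.
by have [/set_mem/gh ->//|_] := boolP (x \in D); rewrite !mul0r.
Qed.

Let bump_bounded_support : exists B : R, forall (M : R) (g : 'rV[R]_n -> R) k,
  continuous g -> (forall x, `|g x| <= M) ->
  bounded_support M B (fun x => bump k x * g x).
Proof.
have [B sB] := bump_support; exists B => M g k cg gM; split.
- by apply: cts_mul => //; exact: bump_continuous.
- move=> x; rewrite normrM (le_trans _ (gM x))// ler_piMl//.
  by rewrite ger0_norm.
- by move=> x /sB ->; rewrite mul0r.
Qed.

Let integral_on_cvg (M : R) (g : 'rV[R]_n -> R) : continuous g ->
  (forall x, `|g x| <= M) ->
  iint (fun x => bump k x * g x) @[k --> \oo] --> integral_on D g.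
Proof.
move=> cg gM; have [B bs] := bump_bounded_support.
apply: (iint_cvg (M := M) (B := B)) => [k|x]; first exact: bs.
by apply: cvgMl; exact: bump_cvg.
Qed.

(** A continuous function may be unbounded off [D]; clamping at a bound valid on [D] makes it
    bounded everywhere and leaves it unchanged on [D]. *)
Let clamp (M : R) (g : 'rV[R]_n -> R) x : R := Num.max (- M) (Num.min M (g x)).

Let clamp_continuous (M : R) (g : 'rV[R]_n -> R) : continuous g -> continuous (clamp M g).
Proof.
move=> cg; apply: cts_max; first exact: cts_cst.
by apply: cts_min => //; exact: cts_cst.
Qed.

Let clamp_bound (M : R) g x : 0 <= M -> `|clamp M g x| <= M.
Proof.
move=> M0; rewrite ler_norml le_max lexx/= ge_max ge_min lexx/= andbT.
lra.
Qed.

Let clamp_id M g x : `|g x| <= M -> clamp M g x = g x.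
Proof.
by rewrite ler_norml => /andP[Mg gM]; rewrite /clamp min_r// max_r.
Qed.

(** Linearity is the point at issue: it is known for [iint] on continuous functions of bounded
    support, so a single sequence of integrals against bumps is shown to have both sides as its
    limit. *)
Lemma pos_functional_integral_on : pos_functional D (integral_on D).
Proof.
split=> //.
- move=> a g h cg ch.
  have [M1 M10 gM1] := compact_norm_bound cD cg.
  have [M2 M20 hM2] := compact_norm_bound cD ch.
  have M0 : 0 <= M1 + M2 by rewrite addr_ge0.
  have gM x : D x -> `|g x| <= M1 + M2 by move=> /gM1/le_trans; apply; rewrite lerDl.
  have hM x : D x -> `|h x| <= M1 + M2 by move=> /hM2/le_trans; apply; rewrite lerDr.
  set M := M1 + M2 in M0 gM hM.
  rewrite (@integral_on_ext (fun x => a * g x + h x)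
    (fun x => a * clamp M g x + clamp M h x)); last first.
    by move=> x Dx; rewrite !clamp_id//; [exact: hM|exact: gM].
  rewrite (@integral_on_ext g (clamp M g)); last first.
    by move=> x Dx; rewrite clamp_id//; exact: gM.
  rewrite (@integral_on_ext h (clamp M h)); last first.
    by move=> x Dx; rewrite clamp_id//; exact: hM.
  have cg' := clamp_continuous (M := M) cg; have ch' := clamp_continuous (M := M) ch.
  have bg' x := @clamp_bound M g x M0; have bh' x := @clamp_bound M h x M0.
  have [B bs] := bump_bounded_support.
  have h1 : iint (fun x => bump k x * (a * clamp M g x + clamp M h x)) @[k --> \oo]
      --> integral_on D (fun x => a * clamp M g x + clamp M h x).
    apply: (@integral_on_cvg (`|a| * M + M)).
      by apply: cts_add => //; apply: cts_mul => //; exact: cts_cst.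
    by move=> x; rewrite (le_trans (ler_normD _ _))// lerD// normrM ler_wpM2l.
  have h2 : iint (fun x => bump k x * (a * clamp M g x + clamp M h x)) @[k --> \oo]
      --> a * integral_on D (clamp M g) + integral_on D (clamp M h).
    under eq_fun.
      move=> k.
      under eq_fun do rewrite mulrDr mulrCA.
      rewrite (iint_lin a (bs M (clamp M g) k cg' bg') (bs M (clamp M h) k ch' bh')).
      over.
    apply: cvgD; last exact: integral_on_cvg bh'.
    by apply: cvgMr; exact: integral_on_cvg bg'.
  by rewrite -(cvg_lim _ h1)// -(cvg_lim _ h2).
- move=> g _ g0; apply: iint_ge0 => x; rewrite indicE.
  by have [/set_mem/g0|_] := boolP (x \in D); rewrite ?mul1r ?mul0r.
Qed.

End integral_on_compact.

(** Compactness in its near-covering form: joint continuity gives the estimate near each [(u0, x)],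
    and compactness yields one neighbourhood of [u0] good for all [x]. *)
Lemma compact_near_uniform (R : realType) (U X : topologicalType) (D : set X)
    (g : U * X -> R) (u0 : U) (e : R) : compact D -> continuous g -> 0 < e ->
  \forall u \near u0, forall x, D x -> `|g (u0, x) - g (u, x)| <= e.
Proof.
move=> /compact_near_coveringP cD cg e0.
apply: (cD _ (nbhs u0) (fun u x => `|g (u0, x) - g (u, x)| <= e)) => x Dx.
pose h (z : X * U) := g (u0, z.1) - g (z.2, z.1).
have ch : continuous h.
  apply: cts_sub; apply: cts_comp cg; apply: cts_pair.
  - exact: cst_continuous.
  - by apply: cts_fst; exact: cts_id.
  - by apply: cts_snd; exact: cts_id.
  - by apply: cts_fst; exact: cts_id.
have /cvgrPdist_le/(_ e e0) := ch (x, u0).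
rewrite /h/= subrr => hz; near=> z.
have : `|0 - (g (u0, z.1) - g (z.2, z.1))| <= e by near: z; exact: hz.
by rewrite sub0r normrN.
Unshelve. all: by end_near. Qed.

Lemma near_le_cts (R : realType) (T : topologicalType) (g : T -> R) (z : T) : continuous g ->
  \forall y \near z, g y <= g z + 1.
Proof.
move=> cg; near=> y; have : `|g z - g y| <= 1.
  by near: y; have /cvgrPdist_le := cg z; apply.
by rewrite ler_norml => /andP[? _]; lra.
Unshelve. all: by end_near. Qed.

Section pos_functional_theory.
Variables (R : realType) (X : topologicalType) (D : set X) (I : (X -> R) -> R).
Hypothesis H : pos_functional D I.

Lemma pf_ext (g h : X -> R) : (forall x, D x -> g x = h x) -> I g = I h.
Proof. by case: H => _ + _ _; exact. Qed.

Lemma pf_compact : compact D. Proof. by case: H => cD _ _ _; exact: cD. Qed.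

Lemma pf_ge0 (g : X -> R) : continuous g -> (forall x, D x -> 0 <= g x) -> 0 <= I g.
Proof. by case: H => _ _ _; exact. Qed.

Lemma pf_lin (a : R) (g h : X -> R) : continuous g -> continuous h ->
  I (fun x => a * g x + h x) = a * I g + I h.
Proof. by case: H => _ _ + _; exact. Qed.

Lemma pf0 : I (fun=> 0) = 0.
Proof.
have := @pf_lin (-1) _ _ (@cts_cst R X 0) (@cts_cst R X 0).
by under eq_fun do rewrite mulr0 addr0; rewrite mulN1r addNr.
Qed.

Lemma pfZ (a : R) (g : X -> R) : continuous g -> I (fun x => a * g x) = a * I g.
Proof.
move=> cg; rewrite -[RHS]addr0 -pf0 -pf_lin//; last exact: cts_cst.
by under [in RHS]eq_fun do rewrite addr0.
Qed.

Lemma pfD (g h : X -> R) : continuous g -> continuous h ->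
  I (fun x => g x + h x) = I g + I h.
Proof.
move=> cg ch; rewrite -[I g]mul1r -pf_lin//.
by under [in RHS]eq_fun do rewrite mul1r.
Qed.

Lemma pfB (g h : X -> R) : continuous g -> continuous h ->
  I (fun x => g x - h x) = I g - I h.
Proof.
move=> cg ch; rewrite [RHS]addrC -mulN1r -pf_lin//.
by under [in RHS]eq_fun do rewrite mulN1r addrC.
Qed.

Lemma pf_sum N (g : 'I_N -> X -> R) : (forall k, continuous (g k)) ->
  I (fun x => \sum_k g k x) = \sum_k I (g k).
Proof.
elim: N g => [|N IH] g cg.
  by rewrite big_ord0; under eq_fun do rewrite big_ord0; exact: pf0.
rewrite big_ord_recl -IH// -pfD//; last exact: cts_sum.
by under eq_fun do rewrite big_ord_recl.
Qed.

Lemma pf_le (g h : X -> R) : continuous g -> continuous h ->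
  (forall x, D x -> g x <= h x) -> I g <= I h.
Proof.
move=> cg ch gh; rewrite -subr_ge0 -pfB//; apply: pf_ge0; first exact: cts_sub.
by move=> x Dx; rewrite subr_ge0 gh.
Qed.

Lemma pf_norm_le (g h : X -> R) : continuous g -> continuous h ->
  (forall x, D x -> `|g x| <= h x) -> `|I g| <= I h.
Proof.
move=> cg ch gh; rewrite ler_norml; apply/andP; split; last first.
  by apply: pf_le => // x Dx; rewrite (le_trans (ler_norm _))// gh.
rewrite lerNl -mulN1r -pfZ//; apply: pf_le => //.
  by apply: cts_mul => //; exact: cts_cst.
by move=> x Dx; rewrite mulN1r (le_trans _ (gh x Dx))// -normrN ler_norm.
Qed.

Lemma pf_mass_ge0 : 0 <= I (fun=> 1).
Proof. by apply: pf_ge0 => //; exact: cts_cst. Qed.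

Lemma pf_bound (M : R) (g : X -> R) : continuous g ->
  (forall x, D x -> `|g x| <= M) -> `|I g| <= M * I (fun=> 1).
Proof.
move=> cg gM; rewrite -pfZ; last exact: cts_cst.
apply: pf_norm_le => //; first by apply: cts_mul; exact: cts_cst.
by move=> x Dx; rewrite mulr1 gM.
Qed.

Lemma cts_slice (U : topologicalType) (g : U * X -> R) (u : U) :
  continuous g -> continuous (fun x => g (u, x)).
Proof.
move=> cg; apply: cts_comp cg; apply: cts_pair; last exact: cts_id.
exact: cst_continuous.
Qed.

Lemma pf_continuous (U : topologicalType) (g : U * X -> R) :
  continuous g -> continuous (fun u => I (fun x => g (u, x))).
Proof.
move=> cg u0; apply/cvgrPdist_le => e e0.
(* The total mass may be 0; adding 1 keeps the denominator positive. *)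
have e'0 : 0 < e / (I (fun=> 1) + 1).
  by rewrite divr_gt0// ltr_wpDl// pf_mass_ge0.
near=> u.
have ue : forall x, D x -> `|g (u0, x) - g (u, x)| <= e / (I (fun=> 1) + 1).
  by near: u; apply: compact_near_uniform => //; exact: pf_compact.
rewrite -pfB; [|exact: cts_slice..].
apply: (le_trans (pf_bound _ ue)).
  by apply: cts_sub; exact: cts_slice.
rewrite mulrAC ler_pdivrMr; last by rewrite ltr_wpDl// pf_mass_ge0.
by rewrite ler_pM2l// lerDl.
Unshelve. all: by end_near. Qed.

End pos_functional_theory.

(** The laws of the outer functional apply because the inner integral is continuous in the outer
    variable, by [pf_continuous]. *)
Lemma pf_prod (R : realType) (X Y : topologicalType) (D : set X) (D' : set Y)
    (I : (X -> R) -> R) (I' : (Y -> R) -> R) :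
  pos_functional D I -> pos_functional D' I' ->
  pos_functional (D `*` D') (fun g => I (fun x => I' (fun y => g (x, y)))).
Proof.
move=> H H'; split.
- by apply: compact_setX; [exact: pf_compact H|exact: pf_compact H'].
- move=> g h gh; apply: (pf_ext H) => x Dx; apply: (pf_ext H') => y D'y.
  exact: gh.
- move=> a g h cg ch; rewrite -(pf_lin H); [|exact: (pf_continuous H')..].
  by apply: (pf_ext H) => x Dx; rewrite (pf_lin H')//; exact: cts_slice.
- move=> g cg g0; apply: (pf_ge0 H); first exact: (pf_continuous H').
  move=> x Dx; apply: (pf_ge0 H'); first exact: cts_slice.
  by move=> y D'y; exact: g0.
Qed.

(** * Fubini for positive functionals *)

Section fubini.
Variables (R : realType) (X : normedModType R) (Y : topologicalType).
Variables (D : set X) (D' : set Y) (I : (X -> R) -> R) (I' : (Y -> R) -> R).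
Hypotheses (H : pos_functional D I) (H' : pos_functional D' I').

Let swapped (g : X * Y -> R) (u : Y * X) := g (u.2, u.1).

Let cts_swapped g : continuous g -> continuous (swapped g).
Proof.
move=> cg; apply: cts_comp cg; apply: cts_pair; [exact: cts_snd (@cts_id _)|].
exact: cts_fst (@cts_id _).
Qed.

Let L (g : X * Y -> R) := I (fun x => I' (fun y => g (x, y))).
Let L' (g : X * Y -> R) := I' (fun y => I (fun x => g (x, y))).

Let posL : pos_functional (D `*` D') L. Proof. exact: pf_prod H H'. Qed.

Let posL' : pos_functional (D `*` D') L'.
Proof.
have [_ e l p] := pf_prod H' H.
split.
- by apply: compact_setX; [exact: pf_compact H|exact: pf_compact H'].
- move=> g h gh; apply: (e (swapped g) (swapped h)) => -[y x] [D'y Dx].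
  exact: gh.
- by move=> a g h cg ch; apply: (l a (swapped g) (swapped h)); exact: cts_swapped.
- move=> g cg g0; apply: (p (swapped g)); first exact: cts_swapped.
  by move=> [y x] [D'y Dx]; exact: g0.
Qed.

(** Equal to 1 within [d / 2] of [c] and to 0 beyond [d]. The norm providing such bumps is the
    reason why [X] is normed while [Y] is any topological space. *)
Let tent (c : X) (d : R) (x : X) : R := Num.min 1 (Num.max 0 (2 - 2 / d * `|x - c|)).

Let tent_cts c d : continuous (tent c d).
Proof.
apply: cts_min; first exact: cts_cst.
apply: cts_max; first exact: cts_cst.
apply: cts_sub; first exact: cts_cst.
apply: cts_mul; first exact: cts_cst.
have cB : continuous (fun x : X => x - c).
  by move=> x; apply: continuousB; [exact: cts_id|exact: cst_continuous].
by move=> x; apply: cvg_norm; exact: cB.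
Qed.

Let tent_ge0 c d x : 0 <= tent c d x.
Proof. by rewrite le_min ler01/= le_max lexx. Qed.

Let tent_le1 c d x : tent c d x <= 1.
Proof. by rewrite ge_min lexx. Qed.

Let tent1 c d x : 0 < d -> `|x - c| <= d / 2 -> tent c d x = 1.
Proof.
move=> d0 xc; rewrite /tent; apply/min_idPl; rewrite le_max; apply/orP; right.
rewrite lerBrDr -lerBrDl mulrAC ler_pdivrMr//; lra.
Qed.

Let tent0 c d x : 0 < d -> d <= `|x - c| -> tent c d x = 0.
Proof.
move=> d0 xc; rewrite /tent (_ : Num.max _ _ = 0) ?min_r//.
by apply/max_idPl; rewrite subr_le0 mulrAC ler_pdivlMr//; lra.
Qed.

(* A partition of unity peeled off one bump at a time: [w = w phi + w (1 - phi)],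
   where on the support of [phi] the function [g] is [e]-close to [g (c, -)], for
   which the two iterated functionals agree. *)
Let fubini_approx (g : X * Y -> R) (e : R) (rad : X -> R) (s : seq X) :
  continuous g ->
  (forall c, c \in s -> 0 < rad c /\ forall x, `|x - c| < rad c ->
     forall y, D' y -> `|g (x, y) - g (c, y)| <= e) ->
  forall w : X -> R, continuous w -> (forall x, 0 <= w x) ->
  (forall x, D x -> (forall c, c \in s -> rad c / 2 < `|x - c|) -> w x = 0) ->
  `|L (fun z => w z.1 * g z) - L' (fun z => w z.1 * g z)|
    <= 2 * (e * (I w * I' (fun=> 1))).
Proof.
move=> cg.
have c1 (w : X -> R) : continuous w -> continuous (fun z : X * Y => w z.1).
  by move=> cw; apply: cts_comp cw; exact: cts_fst (@cts_id _).
have c2 (w : Y -> R) : continuous w -> continuous (fun z : X * Y => w z.2).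
  by move=> cw; apply: cts_comp cw; exact: cts_snd (@cts_id _).
elim: s => [|c s IH] hs w cw w0 wD.
  have w0' x : D x -> w x = 0 by move=> Dx; exact: wD.
  rewrite (pf_ext posL (h := fun=> 0)); last first.
    by move=> [x y] [Dx _] /=; rewrite w0'// mul0r.
  rewrite (pf_ext posL' (h := fun=> 0)); last first.
    by move=> [x y] [Dx _] /=; rewrite w0'// mul0r.
  rewrite (pf0 posL) (pf0 posL') subrr normr0.
  by rewrite (pf_ext H (h := fun=> 0))// (pf0 H) mul0r !mulr0.
have [rc gc] : 0 < rad c /\ forall x, `|x - c| < rad c ->
    forall y, D' y -> `|g (x, y) - g (c, y)| <= e.
  by apply: hs; rewrite mem_head.
pose phi := tent c (rad c).
have cphi : continuous phi by exact: tent_cts.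
pose w1 x := w x * phi x; pose w2 x := w x * (1 - phi x).
have cw1 : continuous w1 by exact: cts_mul.
have cw2 : continuous w2.
  by apply: cts_mul => //; apply: cts_sub => //; exact: cts_cst.
have ww x : w x = w1 x + w2 x by rewrite /w1 /w2 -mulrDr addrC subrK mulr1.
have cwg (v : X -> R) : continuous v -> continuous (fun z => v z.1 * g z).
  by move=> cv; apply: cts_mul => //; exact: c1.
have w10 x : 0 <= w1 x by rewrite mulr_ge0// tent_ge0.
have IH2 : `|L (fun z => w2 z.1 * g z) - L' (fun z => w2 z.1 * g z)|
    <= 2 * (e * (I w2 * I' (fun=> 1))).
  apply: IH => // [c' c's|x|x Dx xs].
  - by apply: hs; rewrite inE c's orbT.
  - by rewrite mulr_ge0// subr_ge0 tent_le1.
  - have [xc|xc] := leP `|x - c| (rad c / 2).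
      by rewrite /w2 /phi tent1// subrr mulr0.
    rewrite /w2 wD ?mul0r// => c'; rewrite inE => /orP[/eqP->//|]; exact: xs.
(* Freezing the first argument of [g] at [c] leaves a function of [x] times a function of [y], and
   on such a product both iterated functionals factor. *)
pose gc' z : R := w1 z.1 * g (c, z.2).
have cgc : continuous (fun y => g (c, y)) by exact: cts_slice.
have cgc' : continuous gc' by apply: cts_mul; [exact: c1|exact: (c2 _ cgc)].
have LL' : L gc' = L' gc'.
  rewrite /L /L' /gc' /=.
  under eq_fun do rewrite (pfZ H')//.
  under [in RHS]eq_fun => y do under eq_fun => x do rewrite mulrC.
  under [in RHS]eq_fun do rewrite (pfZ H)// mulrC.
  rewrite (pfZ H')//.
  by under eq_fun do rewrite mulrC; rewrite (pfZ H)// mulrC.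
(* [M] stands for either iterated functional. Within [rad c] of [c] the closeness of [g] to its
   frozen version applies; farther away [w1] is 0. *)
have bnd M : pos_functional (D `*` D') M -> M (fun z => w1 z.1) = I w1 * I' (fun=> 1) ->
    `|M (fun z => w1 z.1 * g z) - M gc'| <= e * (I w1 * I' (fun=> 1)).
  move=> HM Mw1; rewrite -(pfB HM)//; last exact: cwg.
  rewrite -Mw1 -(pfZ HM); last exact: c1.
  apply: (pf_norm_le HM); first by apply: cts_sub => //; exact: cwg.
    by apply: cts_mul; [exact: cts_cst|exact: c1].
  move=> [x y] [/= Dx D'y]; rewrite /gc'/= -mulrBr normrM ger0_norm// mulrC.
  have [xc|xc] := ltP `|x - c| (rad c); first by rewrite ler_wpM2r// gc.
  by rewrite /w1 /phi tent0// !mulr0.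
have IH1 : `|L (fun z => w1 z.1 * g z) - L' (fun z => w1 z.1 * g z)|
    <= 2 * (e * (I w1 * I' (fun=> 1))).
  have b1 := bnd _ posL; have b2 := bnd _ posL'.
  have -> : L (fun z => w1 z.1 * g z) - L' (fun z => w1 z.1 * g z) =
    (L (fun z => w1 z.1 * g z) - L gc') - (L' (fun z => w1 z.1 * g z) - L' gc').
    by rewrite LL'; ring.
  rewrite (le_trans (ler_normB _ _))// mulr_natl mulr2n lerD//.
    apply: b1; rewrite /L/=.
    under eq_fun => x do rewrite -[w1 x]mulr1.
    under eq_fun do rewrite (pfZ H' _ (@cts_cst _ _ _)) mulrC.
    by rewrite (pfZ H)// mulrC.
  apply: b2; rewrite /L'/=.
  under eq_fun => x do rewrite -[I w1]mulr1.
  by rewrite (pfZ H' _ (@cts_cst _ _ _)).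
have split M : pos_functional (D `*` D') M -> M (fun z => w z.1 * g z) =
    M (fun z => w1 z.1 * g z) + M (fun z => w2 z.1 * g z).
  move=> HM; rewrite -(pfD HM); [|exact: cwg..].
  by under eq_fun do rewrite ww mulrDl.
(* The error is linear in the weight, so the errors of all the bumps add up to that of [w], whatever
   their number. *)
have -> : I w = I w1 + I w2.
  by rewrite -(pfD H)//; congr I; apply/funext => x; exact: ww.
rewrite (split _ posL) (split _ posL') opprD addrACA.
rewrite (le_trans (ler_normD _ _))// [leRHS](_ : _ =
  2 * (e * (I w1 * I' (fun=> 1))) + 2 * (e * (I w2 * I' (fun=> 1)))) ?lerD//.
by ring.
Qed.

Lemma pf_fubini (g : X * Y -> R) : continuous g ->
  I (fun x => I' (fun y => g (x, y))) = I' (fun y => I (fun x => g (x, y))).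
Proof.
move=> cg; rewrite -/(L g) -/(L' g).
apply/eqP; rewrite -subr_eq0 -normr_le0; apply/ler_addgt0Pl => e e0; rewrite addr0.
set c := I (fun=> 1) * I' (fun=> 1).
have c0 : 0 <= c by rewrite mulr_ge0// ?(pf_mass_ge0 H) ?(pf_mass_ge0 H').
(* The approximation leaves an error of at most [2 * e' * c], hence below [e]; the added 1 covers
   the case of zero mass. *)
pose e' := e / (2 * (c + 1)).
have e'0 : 0 < e' by rewrite divr_gt0// mulr_gt0// ltr_wpDl.
have radP b : exists r : R, 0 < r /\ forall x, `|x - b| < r ->
    forall y, D' y -> `|g (x, y) - g (b, y)| <= e'.
  have := compact_near_uniform b (pf_compact H') cg e'0.
  move=> /nbhs_ballP[r /= r0 hr]; exists r; split => // x xc y D'y.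
  by rewrite distrC; apply: hr => //; rewrite -ball_normE/= distrC.
have [rad hrad] := choice radP.
have := pf_compact H; rewrite compact_cover => cD.
(* The cover uses half the radii: there the tent of full radius equals 1, so no point of [D] is left
   over and the weight 1 is admissible. *)
have [|x Dx|s sD Ds] := cD X D (fun c => ball c (rad c / 2)).
- by move=> c' _; exact: ball_open.
- by exists x => //; apply: ballxx; rewrite divr_gt0//; case: (hrad x).
have := @fubini_approx g e' rad (finmap.enum_fset s) cg (fun b _ => hrad b) (fun=> 1)
   (@cts_cst _ _ _) (fun=> ler01).
under eq_fun do rewrite mul1r.
move/(_ _)/le_trans; apply.
  move=> x Dx hx; have [c' /= c's] := Ds x Dx.
  by rewrite -ball_normE/= distrC => /ltW; rewrite leNgt hx.
have : e' * (2 * (c + 1)) = e by rewrite /e' divfK// mulf_neq0// gt_eqF// ltr_wpDl.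
by rewrite -/c => <-; lra.
Qed.

End fubini.

(** * Differentiation under a positive functional *)

Section differential_epsilon.
Variables (R : realType) (V W : normedModType R).

(** Accepts a candidate differential given as a plain function, such as an integral of
    differentials, and packs it as a linear map before appealing to uniqueness of the
    differential. *)
Lemma differentiable_epsP (f L : V -> W) (x : V) :
  linear L -> continuous L ->
  (forall e : R, 0 < e ->
     \forall h \near (0 : V), `|f (x + h) - f x - L h| <= e * `|h|) ->
  differentiable f x /\ 'd f x = L :> (V -> W).
Proof.
move=> linL cL fL.
pose mL := GRing.isLinear.Build R V W *:%R L linL.
pose LL : {linear V -> W} := HB.pack L mL.
have fE : f \o shift x = cst (f x) + LL +o_ 0 id.
  apply/eqaddoP => e e0; near=> h.
  rewrite /= [(_ - _) h]/=.
  have -> : (f \o shift x - (cst (f x) + LL)) h = f (x + h) - f x - L h.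
    by rewrite !fctE/= opprD addrA [h + x]addrC.
  by near: h; exact: fL.
have dE := @diff_unique _ _ _ f LL x cL fE.
split; last by rewrite dE.
by apply/diff_locallyP; rewrite dE; split.
Unshelve. all: by end_near. Qed.

Lemma differentiable_ballP (f L : V -> W) (x : V) :
  linear L -> continuous L ->
  (forall e : R, 0 < e -> exists2 r : R, 0 < r &
     forall h, `|h| < r -> `|f (x + h) - f x - L h| <= e * `|h|) ->
  differentiable f x /\ 'd f x = L :> (V -> W).
Proof.
move=> linL cL fL; apply: differentiable_epsP => // e /fL[r r0 hr].
by near=> h; apply: hr; near: h; exact: nbhs0_lt.
Unshelve. all: by end_near. Qed.

Lemma differentiable_eps (f : V -> W) (x : V) (e : R) : differentiable f x -> 0 < e ->
  \forall h \near (0 : V), `|f (x + h) - f x - 'd f x h| <= e * `|h|.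
Proof.
move=> /diff_locallyP[_ /eqaddoP fE] e0; near=> h.
have -> : f (x + h) - f x - 'd f x h = (f \o shift x - (cst (f x) + 'd f x)) h.
  by rewrite !fctE/= opprD addrA [h + x]addrC.
by near: h; exact: fE.
Unshelve. all: by end_near. Qed.

Lemma differentiable_perturb (f g : V -> W) (x : V) : differentiable g x ->
  (forall e : R, 0 < e -> \forall h \near (0 : V),
     `|f (x + h) - f x - (g (x + h) - g x)| <= e * `|h|) ->
  differentiable f x /\ 'd f x = 'd g x :> (V -> W).
Proof.
move=> dg fg; apply: differentiable_epsP.
- exact: linearP.
- exact: diff_continuous.
- move=> e e0; have e20 : 0 < e / 2 by rewrite divr_gt0.
  near=> h.
  have h1 : `|f (x + h) - f x - (g (x + h) - g x)| <= e / 2 * `|h|.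
    by near: h; exact: fg.
  have h2 : `|g (x + h) - g x - 'd g x h| <= e / 2 * `|h|.
    by near: h; exact: differentiable_eps.
  rewrite -(subrKA (g (x + h) - g x)) (le_trans (ler_normD _ _))//.
  by rewrite (splitr e) mulrDl lerD.
Unshelve. all: by end_near. Qed.

Lemma differentiable_perturb_ball (f g : V -> W) (x : V) : differentiable g x ->
  (forall e : R, 0 < e -> exists2 r : R, 0 < r & forall h, `|h| < r ->
     `|f (x + h) - f x - (g (x + h) - g x)| <= e * `|h|) ->
  differentiable f x /\ 'd f x = 'd g x :> (V -> W).
Proof.
move=> dg fg; apply: differentiable_perturb => // e /fg[r r0 hr].
by near=> h; apply: hr; near: h; exact: nbhs0_lt.
Unshelve. all: by end_near. Qed.

End differential_epsilon.

Lemma differentiable_mean_value (R : realType) (V : normedModType R) (f : V -> R)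
    (x h : V) : (forall y, differentiable f y) ->
  exists2 c : R, 0 < c < 1 & f (x + h) - f x = 'd f (x + c *: h) h.
Proof.
move=> df; pose k (t : R) := x + t *: h.
have dk t : is_diff t k (fun s => s *: h).
  have : is_diff (t : R^o) (cst x + *:%R ^~ h) (0 + *:%R ^~ h) by exact: is_diffD.
  by rewrite add0r.
have dfk t : is_diff t (f \o k) ('d f (k t) \o (fun s => s *: h)).
  by apply: is_diff_comp; apply: differentiableP.
have [||c] := @MVT R (f \o k) (fun t => 'd f (k t) h) 0 1 ltr01.
- move=> t _; apply: DeriveDef; first exact: diff_derivable.
  by rewrite deriveE// diff_val/= scale1r.
- apply: continuous_subspaceT => t; apply: differentiable_continuous.
  exact: ex_diff.
rewrite in_itv/= => c01; rewrite /k scale1r scale0r addr0 subr0 mulr1 => ->.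
by exists c.
Qed.

(** Turns continuity in each fixed direction into estimates uniform over directions, through the
    finite basis. *)
Lemma diff_coord (R : realType) (d : nat) (W : normedModType R) (f : 'rV[R]_d -> W)
    (x v : 'rV[R]_d) :
  'd f x v = \sum_i v ord0 i *: 'd f x (delta_mx ord0 i).
Proof.
rewrite [in LHS](row_sum_delta v) linear_sum; apply: eq_bigr => i _.
by rewrite linearZ.
Qed.

Section diff_under_functional.
Variables (R : realType) (d : nat) (X : topologicalType) (D : set X).
Variable (I : (X -> R) -> R).
Hypothesis H : pos_functional D I.
Variable g : 'rV[R]_d -> X -> R.
Hypothesis dg : forall u x, differentiable (fun u => g u x) u.
Hypothesis cg : continuous (fun z : 'rV[R]_d * X => g z.1 z.2).
Hypothesis cdg : forall v,
  continuous (fun z : 'rV[R]_d * X => 'd (fun u => g u z.2) (z.1) v).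

(** By the mean value theorem the first-order error at [x] is a difference of differentials at two
    nearby parameters. In each basis direction it is small uniformly over [D] by compactness, and
    the functional preserves uniform bounds. *)
Lemma diff_pf u : differentiable (fun u => I (g u)) u /\
  forall v, 'd (fun u => I (g u)) u v = I (fun x => 'd (fun u => g u x) u v).
Proof.
pose L v := I (fun x => 'd (fun u => g u x) u v).
have cgu u' : continuous (g u') by have := cts_slice (u := u') cg; apply.
have cdgu u' v : continuous (fun x => 'd (fun u => g u x) u' v).
  by have := cts_slice (u := u') (@cdg v); apply.
have linL : linear L.
  move=> a v w; rewrite -[RHS]/(a * L v + L w) /L -(pf_lin H)//.
  by congr I; apply/funext => x; rewrite linearP.
have cL : continuous L.
  have -> : L = fun v : 'rV[R]_d => \sum_i v ord0 i * L (delta_mx ord0 i).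
    apply/funext => v; rewrite /L.
    under [in RHS]eq_bigr do rewrite -(pfZ H)//.
    rewrite -(pf_sum H); last by move=> i; apply: cts_mul => //; exact: cts_cst.
    by congr I; apply/funext => x; rewrite diff_coord.
  apply: cts_sum => i; apply: cts_mul; last exact: cts_cst.
  exact: coord_continuous.
suff [dI dE] : differentiable (fun u => I (g u)) u /\
    'd (fun u => I (g u)) u = L :> ('rV[R]_d -> R).
  by split => // v; rewrite dE.
apply: differentiable_ballP => // e e0.
set c := I (fun=> 1); have c0 : 0 <= c by exact: pf_mass_ge0 H.
(* Each of the [d] basis directions contributes [e' * |h|], and integration multiplies by the mass
   [c]. *)
pose e' := e / (d%:R * c + 1).
have den0 : 0 < d%:R * c + 1 by rewrite ltr_wpDl// mulr_ge0.
have e'0 : 0 < e' by rewrite divr_gt0.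
have unif : \forall u' \near u, forall i x, D x ->
    `|'d (fun u => g u x) u (delta_mx ord0 i) -
      'd (fun u => g u x) u' (delta_mx ord0 i)| <= e'.
  apply: (@filter_forall _ _ (fun i u' => forall x, D x ->
    `|'d (fun u => g u x) u (delta_mx ord0 i) -
      'd (fun u => g u x) u' (delta_mx ord0 i)| <= e') (nbhs u)) => i.
  exact: (compact_near_uniform u (pf_compact H) (@cdg (delta_mx ord0 i)) e'0).
have /nbhs_ballP[r /= r0 ballr] := unif.
exists r => // h hr.
have bnd x : D x -> `|g (u + h) x - g u x - 'd (fun u => g u x) u h| <=
    d%:R * e' * `|h|.
  move=> Dx.
  have [t /andP[t0 t1] mv] := differentiable_mean_value u h (fun y => @dg y x).
  have tb : ball u r (u + t *: h).
    rewrite -ball_normE/= opprD addrA subrr sub0r normrN normrZ gtr0_norm//.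
    by rewrite (le_lt_trans _ hr)// ler_piMl// ltW.
  have dgE y : 'd (fun u => g u x) y h =
      \sum_i h ord0 i * 'd (fun u => g u x) y (delta_mx ord0 i).
    exact: diff_coord.
  pose df i y : R := 'd (fun u => g u x) y (delta_mx ord0 i).
  have -> : g (u + h) x - g u x - 'd (fun u => g u x) u h =
      \sum_i h ord0 i * (df i (u + t *: h) - df i u).
    apply: etrans (congr2 (fun a b => a - b) (etrans mv (dgE _)) (dgE u)) _.
    by rewrite -sumrB; apply: eq_bigr => i _; rewrite mulrBr.
  apply: (le_trans (ler_norm_sum _ _ _)).
  apply: (@le_trans _ _ (\sum_(i < d) (e' * `|h|))); last first.
    by rewrite sumr_const card_ord -mulrA mulr_natl.
  apply: ler_sum => i _; rewrite normrM mulrC ler_pM//.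
    by rewrite distrC; exact: ballr _ tb i x Dx.
  exact: ler_mx_entry.
rewrite /L -(pfB H)// -(pfB H)//; last by apply: cts_sub.
apply: (le_trans (pf_bound H _ bnd)).
  by apply: cts_sub => //; exact: cts_sub.
rewrite -/c mulrAC ler_wpM2r//.
have eE : e' * (d%:R * c + 1) = e by rewrite /e' divfK// gt_eqF.
rewrite -eE [leRHS]mulrDr mulr1 (_ : d%:R * e' * c = e' * (d%:R * c)); last by ring.
by rewrite lerDl ltW.
Qed.

End diff_under_functional.

Section partial_differentials.
Variables (R : realType) (A B C W : normedModType R).

Lemma diff_fst (G : A * B -> W) a b : differentiable G (a, b) ->
  is_diff a (fun a => G (a, b)) (fun v => 'd G (a, b) (v, 0)).
Proof.
move=> dG.
have i1 : is_diff a (fun a : A => (a, b)) (fun v => (v, 0)).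
  exact: (@is_diff_pair _ _ _ _ id id (cst b) 0).
exact: (@is_diff_comp _ _ _ _ (fun a : A => (a, b)) _ G _ a i1 (differentiableP dG)).
Qed.

Lemma diff_snd (G : A * B -> W) a b : differentiable G (a, b) ->
  is_diff b (fun b => G (a, b)) (fun v => 'd G (a, b) (0, v)).
Proof.
move=> dG.
have i1 : is_diff b (fun b : B => (a, b)) (fun v => (0, v)).
  exact: (@is_diff_pair _ _ _ _ (cst a) 0 id id).
exact: (@is_diff_comp _ _ _ _ (fun b : B => (a, b)) _ G _ b i1 (differentiableP dG)).
Qed.

End partial_differentials.

(** * Discounted sums *)

Section discounted_sum.
Variables (R : realType) (gamma : R).
Hypothesis gamma01 : 0 <= gamma < 1.

Let g0 : 0 <= gamma. Proof. by case/andP: gamma01. Qed.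
Let g1 : gamma < 1. Proof. by case/andP: gamma01. Qed.
Let og0 : 0 < 1 - gamma. Proof. by rewrite subr_gt0. Qed.

(** [Qfun], [occupancy] and [J0] all unfold to this form, so one set of lemmas serves the three. *)
Definition dsum (u : nat -> R) : R := rseries (fun t => gamma ^+ t * u t).

Lemma dsum_cvg (C : R) u : (forall t, `|u t| <= C) ->
  series (fun t => gamma ^+ t * u t) @ \oo --> dsum u.
Proof.
move=> uC; have C0 : 0 <= C by exact: le_trans (uC 0%N).
suff : cvgn (series (fun t => gamma ^+ t * u t)) by [].
apply: normed_cvg; apply: (@series_le_cvg _ _ (geometric C gamma)).
- by move=> t; exact: normr_ge0.
- by move=> t; rewrite /= mulr_ge0// exprn_ge0.
- by move=> t; rewrite /= normrM mulrC (ger0_norm (exprn_ge0 t g0)) ler_wpM2r// exprn_ge0.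
- by apply: is_cvg_geometric_series; rewrite ger0_norm.
Qed.

Lemma dsum_lin (C : R) (a : R) u v : (forall t, `|u t| <= C) -> (forall t, `|v t| <= C) ->
  dsum (fun t => a * u t + v t) = a * dsum u + dsum v.
Proof.
move=> uC vC; apply/cvg_lim => //.
have -> : series (fun t => gamma ^+ t * (a * u t + v t)) =
    (fun n => a * series (fun t => gamma ^+ t * u t) n +
              series (fun t => gamma ^+ t * v t) n).
  apply/funext => n; rewrite /series/= mulr_sumr -big_split/=.
  by apply: eq_bigr => t _; rewrite mulrDr mulrCA.
apply: cvgD; last exact: dsum_cvg vC.
by apply: cvgMr; exact: dsum_cvg uC.
Qed.

Lemma dsum_bound (C : R) u : (forall t, `|u t| <= C) -> `|dsum u| <= C / (1 - gamma).
Proof.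
move=> uC; have C0 : 0 <= C by exact: le_trans (uC 0%N).
have cu := dsum_cvg uC.
have /cvg_lim <- // : `|series (fun t => gamma ^+ t * u t) n| @[n --> \oo] --> `|dsum u|.
  exact: cvg_norm.
apply: limr_le; first by apply: is_cvg_norm; apply/cvg_ex; exists (dsum u).
near=> n; rewrite /series/= (le_trans (ler_norm_sum _ _ _))//.
apply: (@le_trans _ _ (series (geometric C gamma) n)).
  apply: ler_sum => t _; rewrite /= normrM mulrC (ger0_norm (exprn_ge0 t g0)).
  by rewrite ler_wpM2r// exprn_ge0.
rewrite geometric_seriesE ?lt_eqF//= -mulrA ler_wpM2l//.
by rewrite ler_pdivrMr// mulVf ?gt_eqF// gerBl exprn_ge0.
Unshelve. all: by end_near. Qed.

Lemma dsum_shift (C : R) u : (forall t, `|u t| <= C) ->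
  dsum u = u 0%N + gamma * dsum (fun t => u t.+1).
Proof.
move=> uC; apply/cvg_lim => //; rewrite -(cvg_shiftS _).
have -> : (fun n => series (fun t => gamma ^+ t * u t) n.+1) =
   (fun n => u 0%N + gamma * series (fun t => gamma ^+ t * u t.+1) n).
  apply/funext => n; rewrite /series/= big_nat_recl// expr0 mul1r; congr (_ + _).
  by rewrite mulr_sumr; apply: eq_bigr => t _; rewrite exprS mulrA.
apply: cvgD; first exact: cvg_cst.
by apply: cvgMr; apply: (@dsum_cvg C) => t; exact: uC.
Qed.

Lemma dsum_tail (C : R) n u : (forall t, `|u t| <= C) ->
  `|dsum u - \sum_(t < n) gamma ^+ t * u t| <= gamma ^+ n * (C / (1 - gamma)).
Proof.
elim: n u => [|n IH] u uC.
  by rewrite big_ord0 subr0 expr0 mul1r; exact: dsum_bound.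
rewrite big_ord_recl/= expr0 mul1r (dsum_shift uC) opprD addrACA subrr add0r.
have -> : \sum_(i < n) gamma ^+ bump 0 i * u (bump 0 i) =
    gamma * \sum_(i < n) gamma ^+ i * u i.+1.
  by rewrite mulr_sumr; apply: eq_bigr => i _; rewrite /bump/= add1n exprS mulrA.
rewrite -mulrBr normrM ger0_norm// exprS -mulrA ler_wpM2l//.
by apply: IH => t; exact: uC.
Qed.

Lemma geometric_small (K e : R) : 0 < e -> exists n, gamma ^+ n * K <= e.
Proof.
move=> e0; have : geometric K gamma @ \oo --> 0.
  by apply: cvg_geometric; rewrite ger0_norm.
move=> /cvgrPdist_le/(_ e e0)[n _ /(_ n (leqnn n))] /=.
rewrite sub0r normrN => h; exists n; rewrite mulrC.
by rewrite (le_trans (ler_norm _)).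
Qed.

(** A bound uniform in [t] near each point suffices: tails are then uniformly small near [x], and a
    partial sum is a finite sum of continuous functions. *)
Lemma dsum_continuous (T : topologicalType) (u : nat -> T -> R) :
  (forall t, continuous (u t)) ->
  (forall x : T, exists C : R, \forall y \near x, forall t, `|u t y| <= C) ->
  continuous (fun x => dsum (u ^~ x)).
Proof.
move=> cu uC x; apply/cvgrPdist_le => e e0.
have [C nC] := uC x.
have e30 : 0 < e / 3 by rewrite divr_gt0.
have [n hn] := @geometric_small (C / (1 - gamma)) _ e30.
have cS : continuous (fun y => \sum_(t < n) gamma ^+ t * u t y).
  by apply: cts_sum => t; apply: cts_mul; [exact: cts_cst|exact: cu].
have uxC t : `|u t x| <= C by apply: (nbhs_singleton nC).
near=> y.
have uyC t : `|u t y| <= C by move: t; near: y; exact: nC.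
have h1 := le_trans (dsum_tail n uxC) hn.
have h2 := le_trans (dsum_tail n uyC) hn.
have h3 : `|\sum_(t < n) gamma ^+ t * u t x - \sum_(t < n) gamma ^+ t * u t y| <= e / 3.
  by near: y; have /cvgrPdist_le := cS x; exact.
move: h1 h2 h3; rewrite !ler_norml => /andP[? ?] /andP[? ?] /andP[? ?].
by apply/andP; split; lra.
Unshelve. all: by end_near. Qed.

(** For a partial sum the exchange is linearity, and both tails are geometric. The sum is a separate
    function [w], continuous everywhere but equal to the series on [D] only, where the terms are
    bounded. *)
Lemma dsum_pf (X : topologicalType) (D : set X) (I : (X -> R) -> R)
    (u : nat -> X -> R) (w : X -> R) (C : R) : pos_functional D I ->
  (forall t, continuous (u t)) -> continuous w ->
  (forall x, D x -> w x = dsum (u ^~ x)) ->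
  (forall t x, D x -> `|u t x| <= C) ->
  I w = dsum (fun t => I (u t)).
Proof.
move=> H cu cw wE uC.
apply/eqP; rewrite -subr_eq0 -normr_le0; apply/ler_addgt0Pl => e e0; rewrite addr0.
have e20 : 0 < e / 2 by rewrite divr_gt0.
pose m := I (fun=> 1).
have [n hn] := @geometric_small (C / (1 - gamma) * m) _ e20.
have cS : continuous (fun y => \sum_(t < n) gamma ^+ t * u t y).
  by apply: cts_sum => t; apply: cts_mul; [exact: cts_cst|exact: cu].
have IS : I (fun y => \sum_(t < n) gamma ^+ t * u t y) =
    \sum_(t < n) gamma ^+ t * I (u t).
  rewrite (pf_sum H); last by move=> t; apply: cts_mul; [exact: cts_cst|exact: cu].
  by apply: eq_bigr => t _; rewrite (pfZ H).
have h1 : `|I w - \sum_(t < n) gamma ^+ t * I (u t)| <= e / 2.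
  rewrite -IS -(pfB H)//; apply: le_trans hn; rewrite mulrA.
  apply: (pf_bound H); first exact: cts_sub.
  by move=> x Dx; rewrite wE//; apply: dsum_tail => t; exact: uC.
have h2 : `|dsum (fun t => I (u t)) - \sum_(t < n) gamma ^+ t * I (u t)| <= e / 2.
  apply: le_trans hn; rewrite mulrAC; apply: dsum_tail => t.
  by apply: (pf_bound H) => //; exact: uC.
move: h1 h2; rewrite !ler_norml => /andP[? ?] /andP[? ?].
by apply/andP; split; lra.
Qed.

Lemma dsumZ (C : R) (a : R) u : (forall t, `|u t| <= C) ->
  dsum (fun t => a * u t) = a * dsum u.
Proof.
move=> uC; apply/cvg_lim => //.
have -> : series (fun t => gamma ^+ t * (a * u t)) =
    (fun n => a * series (fun t => gamma ^+ t * u t) n).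
  apply/funext => n; rewrite /series/= mulr_sumr.
  by apply: eq_bigr => t _; rewrite mulrCA.
by apply: cvgMr; exact: dsum_cvg uC.
Qed.

Lemma dsumD (C : R) u v : (forall t, `|u t| <= C) -> (forall t, `|v t| <= C) ->
  dsum (fun t => u t + v t) = dsum u + dsum v.
Proof.
move=> uC vC; rewrite -[dsum u]mul1r -(dsum_lin _ uC vC).
by congr dsum; apply/funext => t; rewrite mul1r.
Qed.

Lemma dsum_telescope (C : R) b : (forall t, `|b t| <= C) ->
  dsum (fun t => b t - gamma * b t.+1) = b 0%N.
Proof.
move=> bC; have -> : (fun t => b t - gamma * b t.+1) =
    (fun t => - gamma * b t.+1 + b t).
  by apply/funext => t; rewrite addrC mulNr.
rewrite (@dsum_lin C _ (fun t => b t.+1))//.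
by rewrite (dsum_shift bC) mulNr [LHS]addrC addrK.
Qed.

End discounted_sum.

(** * Policy evaluation and performance difference *)

Section policy_evaluation.
Variables (R : realType) (n m : nat).
Variables (S : set 'rV[R]_n) (A : set 'rV[R]_m).
Variable p : 'rV[R]_n -> 'rV[R]_m -> 'rV[R]_n -> R.
Variable d0 : 'rV[R]_n -> R.
Variable gamma : R.
Hypothesis HS : pos_functional S (@integral_on R n S).
Hypothesis HA : pos_functional A (@integral_on R m A).
Hypothesis gamma01 : 0 <= gamma < 1.
Hypothesis p_ge0 : forall s a s', S s -> A a -> S s' -> 0 <= p s a s'.
Hypothesis p_mass : forall s a, S s -> A a -> integral_on S (p s a) = 1.
Hypothesis d0_ge0 : forall s, S s -> 0 <= d0 s.
Hypothesis d0_mass : integral_on S d0 = 1.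
Hypothesis cp :
  continuous (fun x : 'rV[R]_n * 'rV[R]_m * 'rV[R]_n => p x.1.1 x.1.2 x.2).
Hypothesis cd0 : continuous d0.

Definition cts2 (g : 'rV[R]_n -> 'rV[R]_m -> R) :=
  continuous (fun z : 'rV[R]_n * 'rV[R]_m => g z.1 z.2).

Definition is_policy (pol : 'rV[R]_n -> 'rV[R]_m -> R) :=
  [/\ cts2 pol, forall s a, S s -> A a -> 0 <= pol s a &
      forall s, S s -> integral_on A (pol s) = 1].

Definition act_mean (pol g : 'rV[R]_n -> 'rV[R]_m -> R) s : R :=
  integral_on A (fun a => pol s a * g s a).

(** [Pop] unfolds to [next_mean] after [act_mean]; the splitting isolates the policy in the second
    factor. *)
Definition next_mean (h : 'rV[R]_n -> R) s a : R :=
  integral_on S (fun s' => p s a s' * h s').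

Lemma cts2_slice g s : cts2 g -> continuous (g s).
Proof. by move=> cg; have := cts_slice (u := s) cg; apply. Qed.

Lemma cts_p s a : continuous (p s a).
Proof. by have := cts_slice (u := (s, a)) cp; apply. Qed.

Lemma act_mean_cts pol g : cts2 pol -> cts2 g -> continuous (act_mean pol g).
Proof.
move=> cpol cg.
have cm : continuous (fun z : 'rV[R]_n * 'rV[R]_m => pol z.1 z.2 * g z.1 z.2).
  exact: cts_mul.
by have := pf_continuous HA cm; apply.
Qed.

Lemma next_mean_cts (h : 'rV[R]_n -> R) : continuous h -> cts2 (next_mean h).
Proof.
move=> ch.
have cm : continuous (fun z : 'rV[R]_n * 'rV[R]_m * 'rV[R]_n =>
    p z.1.1 z.1.2 z.2 * h z.2).
  by apply: cts_mul => //; apply: cts_comp ch; exact: cts_snd (@cts_id _).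
by have := pf_continuous HS cm; apply.
Qed.

Lemma next_mean_bound (h : 'rV[R]_n -> R) (M : R) s a : continuous h ->
  (forall s', S s' -> `|h s'| <= M) -> S s -> A a -> `|next_mean h s a| <= M.
Proof.
move=> ch hM Ss Aa; rewrite -[M]mulr1 -(p_mass Ss Aa) -(pfZ HS); last exact: cts_p.
apply: (pf_norm_le HS).
- by apply: cts_mul => //; exact: cts_p.
- by apply: cts_mul; [exact: cts_cst|exact: cts_p].
- move=> s' Ss'; rewrite normrM ger0_norm ?p_ge0// mulrC ler_wpM2r ?p_ge0//.
  exact: hM.
Qed.

Lemma next_mean1 s a : S s -> A a -> next_mean (fun=> 1) s a = 1.
Proof.
move=> Ss Aa; rewrite -[RHS](p_mass Ss Aa).
by apply: (pf_ext HS) => s' _; rewrite mulr1.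
Qed.

Section fixed_policy.
Variable pol : 'rV[R]_n -> 'rV[R]_m -> R.
Hypothesis polP : is_policy pol.

Let cpol : cts2 pol. Proof. by case: polP => cpol _ _; exact: cpol. Qed.
Let pol_ge0 s a : S s -> A a -> 0 <= pol s a.
Proof. by case: polP => _ + _; exact. Qed.
Let pol_mass s : S s -> integral_on A (pol s) = 1.
Proof. by case: polP => _ _; exact. Qed.

Lemma act_mean_bound g (M : R) s : cts2 g ->
  (forall a, A a -> `|g s a| <= M) -> S s -> `|act_mean pol g s| <= M.
Proof.
move=> cg gM Ss; have cps := cts2_slice (s := s) cpol.
rewrite -[M]mulr1 -(pol_mass Ss) -(pfZ HA)//.
apply: (pf_norm_le HA).
- by apply: cts_mul => //; exact: cts2_slice.
- by apply: cts_mul => //; exact: cts_cst.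
- move=> a Aa; rewrite normrM ger0_norm ?pol_ge0// mulrC ler_wpM2r ?pol_ge0//.
  exact: gM.
Qed.

Lemma act_mean_cst (g : 'rV[R]_n -> R) s : S s ->
  act_mean pol (fun s _ => g s) s = g s.
Proof.
move=> Ss; rewrite /act_mean; under eq_fun do rewrite mulrC.
by rewrite (pfZ HA) ?pol_mass ?mulr1//; exact: cts2_slice.
Qed.

Let dens := state_dens S A p d0 pol.

Definition state_mean t (h : 'rV[R]_n -> R) : R :=
  integral_on S (fun s => dens t s * h s).

Lemma state_dens_cts t : continuous (dens t).
Proof.
elim: t => [|t IH]; first exact: cd0.
have ck : continuous (fun z : ('rV[R]_n * 'rV[R]_n) * 'rV[R]_m =>
    pol z.1.2 z.2 * p z.1.2 z.2 z.1.1).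
  have c1 := cts_fst (cts_fst (@cts_id (('rV[R]_n * 'rV[R]_n) * 'rV[R]_m)%type)).
  have c2 := cts_snd (cts_fst (@cts_id (('rV[R]_n * 'rV[R]_n) * 'rV[R]_m)%type)).
  have c3 := cts_snd (@cts_id (('rV[R]_n * 'rV[R]_n) * 'rV[R]_m)%type).
  apply: cts_mul; first exact: (cts_comp (cts_pair c2 c3) cpol).
  exact: (cts_comp (cts_pair (cts_pair c2 c3) c1) cp).
have ck' : continuous (fun z : 'rV[R]_n * 'rV[R]_n =>
    dens t z.2 * integral_on A (fun a => pol z.2 a * p z.2 a z.1)).
  apply: cts_mul; first exact: (cts_comp (cts_snd (@cts_id _)) IH).
  exact: (pf_continuous HA ck).
exact: (pf_continuous HS ck').
Qed.

(** Moves the forward recursion of densities onto the test function, by two uses of Fubini: [s'] is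
    exchanged with [s], then with [a]. *)
Lemma state_mean_step t (h : 'rV[R]_n -> R) : continuous h ->
  state_mean t.+1 h = state_mean t (act_mean pol (next_mean h)).
Proof.
move=> ch; rewrite /state_mean /act_mean /next_mean /=.
have cid3 := @cts_id (('rV[R]_n * 'rV[R]_n) * 'rV[R]_m)%type.
have c1 := cts_fst (cts_fst cid3); have c2 := cts_snd (cts_fst cid3).
have c3 := cts_snd cid3.
have cid2 := @cts_id ('rV[R]_n * 'rV[R]_n)%type.
have ck : continuous (fun z : ('rV[R]_n * 'rV[R]_n) * 'rV[R]_m =>
    pol z.1.2 z.2 * p z.1.2 z.2 z.1.1).
  apply: cts_mul; first exact: (cts_comp (cts_pair c2 c3) cpol).
  exact: (cts_comp (cts_pair (cts_pair c2 c3) c1) cp).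
have ck' : continuous (fun z : 'rV[R]_n * 'rV[R]_n =>
    dens t z.2 * integral_on A (fun a => pol z.2 a * p z.2 a z.1)).
  apply: cts_mul; first exact: (cts_comp (cts_snd cid2) (@state_dens_cts t)).
  exact: (pf_continuous HA ck).
transitivity (integral_on S (fun s' => integral_on S (fun s =>
    h s' * (dens t s * integral_on A (fun a => pol s a * p s a s'))))).
  apply: (pf_ext HS) => s' _; rewrite (pfZ HS) 1?mulrC//.
  exact: (cts_slice (u := s') ck').
have ck'' : continuous (fun z : 'rV[R]_n * 'rV[R]_n => h z.1 *
    (dens t z.2 * integral_on A (fun a => pol z.2 a * p z.2 a z.1))).
  by apply: cts_mul => //; exact: (cts_comp (cts_fst cid2) ch).
rewrite (pf_fubini HS HS ck''); apply: (pf_ext HS) => s _ /=.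
have cs : continuous (fun z : 'rV[R]_n * 'rV[R]_m => h z.1 * (pol s z.2 * p s z.2 z.1)).
  have d1 := cts_fst (@cts_id ('rV[R]_n * 'rV[R]_m)%type).
  have d2 := cts_snd (@cts_id ('rV[R]_n * 'rV[R]_m)%type).
  apply: cts_mul; first exact: (cts_comp d1 ch).
  have ds : continuous (fun _ : 'rV[R]_n * 'rV[R]_m => s) by exact: cst_continuous.
  apply: cts_mul; first exact: (cts_comp (cts_pair ds d2) cpol).
  exact: (cts_comp (cts_pair (cts_pair ds d2) d1) cp).
have csl s' : continuous (fun a => pol s a * p s a s').
  by have := cts_slice (u := (s', s)) ck; apply.
transitivity (dens t s * integral_on S (fun s' => integral_on A (fun a =>
    h s' * (pol s a * p s a s')))).
  rewrite -(pfZ HS); last by have := pf_continuous HA cs; apply.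
  by apply: (pf_ext HS) => s' _; rewrite (pfZ HA)// mulrCA.
congr (_ * _); rewrite (pf_fubini HS HA cs); apply: (pf_ext HA) => a _ /=.
rewrite -(pfZ HS); last by apply: cts_mul => //; exact: cts_p.
by apply: (pf_ext HS) => s' _; rewrite mulrC mulrA.
Qed.

Lemma state_dens_ge0 t s : S s -> 0 <= dens t s.
Proof.
elim: t s => [|t IH] s Ss; first exact: d0_ge0.
have cid3 := @cts_id ('rV[R]_n * 'rV[R]_m)%type.
have cs : continuous (fun _ : 'rV[R]_n * 'rV[R]_m => s) by exact: cst_continuous.
have ck : continuous (fun z : 'rV[R]_n * 'rV[R]_m => pol z.1 z.2 * p z.1 z.2 s).
  by apply: cts_mul => //; exact: (cts_comp (cts_pair cid3 cs) cp).
apply: (pf_ge0 HS).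
  apply: cts_mul; first exact: state_dens_cts.
  exact: (pf_continuous HA ck).
move=> s' Ss'; rewrite mulr_ge0 ?IH//; apply: (pf_ge0 HA).
  by have := cts_slice (u := s') ck; apply.
by move=> a Aa; rewrite mulr_ge0 ?pol_ge0 ?p_ge0.
Qed.

Lemma state_dens_mass t : integral_on S (dens t) = 1.
Proof.
elim: t => [|t IH]; first exact: d0_mass.
transitivity (state_mean t.+1 (fun=> 1)).
  by apply: (pf_ext HS) => s _; rewrite mulr1.
rewrite state_mean_step; last exact: cts_cst.
rewrite -[RHS]IH; apply: (pf_ext HS) => s Ss.
rewrite -[RHS]mulr1; congr (_ * _); rewrite -[RHS](act_mean_cst (fun=> 1) Ss).
by apply: (pf_ext HA) => a Aa; congr (_ * _); exact: next_mean1.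
Qed.

Lemma state_mean_bound t (h : 'rV[R]_n -> R) (M : R) : continuous h ->
  (forall s, S s -> `|h s| <= M) -> `|state_mean t h| <= M.
Proof.
move=> ch hM; have cd := @state_dens_cts t.
rewrite -[M]mulr1 -(state_dens_mass t) -(pfZ HS)//; apply: (pf_norm_le HS).
- exact: cts_mul.
- by apply: cts_mul => //; exact: cts_cst.
- move=> s Ss; have ds := state_dens_ge0 t Ss.
  by rewrite normrM ger0_norm// mulrC ler_wpM2r// hM.
Qed.

Lemma state_mean_ext t (g h : 'rV[R]_n -> R) : (forall s, S s -> g s = h s) ->
  state_mean t g = state_mean t h.
Proof. by move=> gh; apply: (pf_ext HS) => s Ss; rewrite gh. Qed.

Lemma state_mean_lin t (a : R) (g h : 'rV[R]_n -> R) : continuous g -> continuous h ->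
  state_mean t (fun s => a * g s + h s) = a * state_mean t g + state_mean t h.
Proof.
move=> cg ch; have cd := @state_dens_cts t.
rewrite /state_mean -(pf_lin HS); [|exact: cts_mul..].
by apply: (pf_ext HS) => s _; rewrite mulrDr mulrCA.
Qed.

Section value.
Variable r : 'rV[R]_n -> 'rV[R]_m -> R.
Hypothesis cr : cts2 r.

Let u t := iter t (Pop S A p pol) r.

Lemma iter_Pop_cts t : cts2 (u t).
Proof.
elim: t => [|t IH]; first exact: cr.
by apply: next_mean_cts; exact: act_mean_cts.
Qed.

Lemma iter_Pop_bound (M : R) t s a :
  (forall s a, S s -> A a -> `|r s a| <= M) -> S s -> A a -> `|u t s a| <= M.
Proof.
move=> rM; elim: t s a => [|t IH] s a Ss Aa; first exact: rM.
apply: next_mean_bound => //; first exact: (act_mean_cts cpol (@iter_Pop_cts t)).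
move=> s' Ss'; apply: act_mean_bound => //; first exact: iter_Pop_cts.
by move=> a' Aa'; exact: IH.
Qed.

Lemma reward_bound : exists2 M : R, 0 <= M &
  forall s a, S s -> A a -> `|r s a| <= M.
Proof.
have [M M0 rM] := compact_norm_bound
  (compact_setX (pf_compact HS) (pf_compact HA)) cr.
by exists M => // s a Ss Aa; exact: (rM (s, a)).
Qed.

(** Off [S] and [A] the function [p s a] need not be a probability density. One application of [Pop]
    nevertheless reads the previous iterate over [S] and [A] only, where it is at most [M]; so [M]
    times the integral of [|p|], continuous in [(s, a)], bounds all iterates after the zeroth. *)
Lemma iter_Pop_locally_bounded (z : 'rV[R]_n * 'rV[R]_m) :
  exists C : R, \forall y \near z, forall t, `|u t y.1 y.2| <= C.
Proof.
have [M M0 rM] := reward_bound.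
pose b (y : 'rV[R]_n * 'rV[R]_m) := M * integral_on S (fun s' => `|p y.1 y.2 s'|).
have cnp : continuous (fun x : 'rV[R]_n * 'rV[R]_m * 'rV[R]_n =>
    `|p x.1.1 x.1.2 x.2|) by exact: cts_norm.
have cb : continuous b.
  by apply: cts_mul; [exact: cts_cst|exact: (pf_continuous HS cnp)].
have cnr : continuous (fun y : 'rV[R]_n * 'rV[R]_m => `|r y.1 y.2|) by exact: cts_norm.
exists (Num.max (`|r z.1 z.2| + 1) (b z + 1)).
have n1 := near_le_cts z cnr; have n2 := near_le_cts z cb.
apply: filterS2 n1 n2 => y y1 y2 [|t]; first by rewrite le_max y1.
rewrite le_max; apply/orP; right; apply: le_trans y2.
have ca : continuous (act_mean pol (u t)) by exact: (act_mean_cts cpol (@iter_Pop_cts t)).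
have cnps : continuous (fun s' => `|p y.1 y.2 s'|).
  by apply: cts_norm; exact: cts_p.
rewrite /b -(pfZ HS)//; apply: (pf_norm_le HS).
- by apply: cts_mul => //; exact: cts_p.
- by apply: cts_mul => //; exact: cts_cst.
- move=> s' Ss'; rewrite normrM mulrC ler_wpM2r//.
  apply: act_mean_bound => //; first exact: iter_Pop_cts.
  by move=> a' Aa'; exact: iter_Pop_bound.
Qed.

Let Q := Qfun S A p r gamma pol.

Lemma Qfun_cts : cts2 Q.
Proof.
have h := @dsum_continuous _ _ gamma01 _
  (fun t (z : 'rV[R]_n * 'rV[R]_m) => u t z.1 z.2) iter_Pop_cts iter_Pop_locally_bounded.
exact: h.
Qed.

Lemma Qfun_bound (M : R) s a :
  (forall s a, S s -> A a -> `|r s a| <= M) -> S s -> A a ->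
  `|Q s a| <= M / (1 - gamma).
Proof.
move=> rM Ss Aa; apply: (dsum_bound gamma01) => t; exact: iter_Pop_bound.
Qed.

Lemma act_mean_Qfun s : S s -> act_mean pol Q s = dsum gamma (fun t => act_mean pol (u t) s).
Proof.
move=> Ss; have [M M0 rM] := reward_bound.
have cps := cts2_slice (s := s) cpol.
have [K K0 pK] := compact_norm_bound (pf_compact HA) cps.
apply: (@dsum_pf _ _ gamma01 _ _ _ (fun t a => pol s a * u t s a) _ (K * M) HA).
- by move=> t; apply: cts_mul => //; exact: (cts2_slice (s := s) (@iter_Pop_cts t)).
- by apply: cts_mul => //; exact: (cts2_slice (s := s) Qfun_cts).
- move=> a Aa; rewrite (@dsumZ _ _ gamma01 M)// => t; exact: iter_Pop_bound.
- by move=> t a Aa; rewrite normrM ler_pM ?pK//; exact: iter_Pop_bound.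
Qed.

(** Shifts the series by one step and exchanges the sum with the integral over the next state. It
    holds at every [(s, a)], inside [S] and [A] or not, as differentiation in [a] on the whole space
    demands. *)
Lemma Qfun_bellman s a :
  Q s a = r s a + gamma * next_mean (act_mean pol Q) s a.
Proof.
have [M M0 rM] := reward_bound.
have [C /nbhs_singleton/= uC] := iter_Pop_locally_bounded (s, a).
rewrite /Q /Qfun -/(dsum gamma (fun t => u t s a)) (dsum_shift gamma01 uC).
congr (_ + _ * _).
have [K K0 pK] := compact_norm_bound (pf_compact HS) (@cts_p s a).
have ca t : continuous (act_mean pol (u t)) by exact: (act_mean_cts cpol (@iter_Pop_cts t)).
have aM t s' : S s' -> `|act_mean pol (u t) s'| <= M.
  move=> Ss'; apply: act_mean_bound => //; first exact: iter_Pop_cts.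
  by move=> a' Aa'; exact: iter_Pop_bound.
apply/esym; apply: (@dsum_pf _ _ gamma01 _ _ _
  (fun t s' => p s a s' * act_mean pol (u t) s') _ (K * M) HS).
- by move=> t; apply: cts_mul => //; exact: cts_p.
- by apply: cts_mul; [exact: cts_p|exact: (act_mean_cts cpol Qfun_cts)].
- move=> s' Ss'; rewrite act_mean_Qfun// (@dsumZ _ _ gamma01 M)// => t.
  exact: aM.
- by move=> t s' Ss'; rewrite normrM ler_pM ?pK ?aM.
Qed.

End value.

(** After the first step a density is an average of values of [p], so one bound on [p] serves all
    later times. *)
Lemma state_dens_bound : exists C : R, forall t s, S s -> `|dens t s| <= C.
Proof.
have [K K0 pK] := compact_norm_bound
  (compact_setX (compact_setX (pf_compact HS) (pf_compact HA)) (pf_compact HS)) cp.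
have [K' K'0 dK'] := compact_norm_bound (pf_compact HS) cd0.
exists (Num.max K' K) => -[|t] s Ss; first by rewrite le_max dK'.
rewrite le_max; apply/orP; right.
have cs : continuous (fun _ : 'rV[R]_n * 'rV[R]_m => s) by exact: cst_continuous.
have cps : cts2 (fun s' a => p s' a s).
  exact: (cts_comp (cts_pair (@cts_id _) cs) cp).
(* [dens t.+1 s] unfolds to the time-[t] state mean of the averaged transition density into [s]. *)
apply: (@state_mean_bound t (act_mean pol (fun s' a => p s' a s))).
  exact: act_mean_cts.
move=> s' Ss'; apply: act_mean_bound => // a Aa.
by apply: (pK (s', a, s)).
Qed.

(** [s0] may lie outside [S], so [p] is bounded on [S] and [A] with target near [s0], starting from
    its bound at [s0] itself. *)
Lemma occupancy_cts : continuous (occupancy S A p d0 gamma pol).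
Proof.
apply: (@dsum_continuous _ _ gamma01 _ dens state_dens_cts) => s0.
have cD := compact_setX (pf_compact HS) (pf_compact HA).
have c1 := cts_fst (@cts_id ('rV[R]_n * ('rV[R]_n * 'rV[R]_m))%type).
have c2 := cts_snd (@cts_id ('rV[R]_n * ('rV[R]_n * 'rV[R]_m))%type).
have cp' : continuous (fun z : 'rV[R]_n * ('rV[R]_n * 'rV[R]_m) => p z.2.1 z.2.2 z.1).
  exact: (cts_comp (cts_pair c2 c1) cp).
have [K K0 pK] := compact_norm_bound cD (cts_slice (u := s0) cp').
have n1 := compact_near_uniform s0 cD cp' (@ltr01 R).
have n2 := near_le_cts s0 (cts_norm cd0).
exists (Num.max (`|d0 s0| + 1) (K + 1)).
apply: filterS2 n1 n2 => s y1 y2 [|t]; first by rewrite le_max y2.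
rewrite le_max; apply/orP; right.
have cs : continuous (fun _ : 'rV[R]_n * 'rV[R]_m => s) by exact: cst_continuous.
have cps : cts2 (fun s' a => p s' a s).
  exact: (cts_comp (cts_pair (@cts_id _) cs) cp).
apply: (@state_mean_bound t (act_mean pol (fun s' a => p s' a s))).
  exact: act_mean_cts.
move=> s' Ss'; apply: act_mean_bound => // a Aa.
have h1 : `|p s' a s0 - p s' a s| <= 1 by apply: (y1 (s', a)).
have h2 : `|p s' a s0| <= K by apply: (pK (s', a)).
move: h1 h2; rewrite !ler_norml => /andP[? ?] /andP[? ?].
by apply/andP; split; lra.
Qed.

Lemma occupancy_mean (h : 'rV[R]_n -> R) : continuous h ->
  integral_on S (fun s => occupancy S A p d0 gamma pol s * h s) =
  dsum gamma (fun t => state_mean t h).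
Proof.
move=> ch; have [C dC] := state_dens_bound.
have [K K0 hK] := compact_norm_bound (pf_compact HS) ch.
apply: (@dsum_pf _ _ gamma01 _ _ _ (fun t s => dens t s * h s) _ (C * K) HS).
- by move=> t; apply: cts_mul => //; exact: state_dens_cts.
- by apply: cts_mul => //; exact: occupancy_cts.
- move=> s Ss; rewrite mulrC /occupancy -/(dsum gamma (dens ^~ s)).
  rewrite -(@dsumZ _ _ gamma01 C); last by move=> t; exact: dC.
  by congr dsum; apply/funext => t; rewrite mulrC.
- by move=> t s Ss; rewrite normrM ler_pM ?dC ?hK.
Qed.

End fixed_policy.

Lemma act_mean_dist pol pol' g (k M : R) s : cts2 pol -> cts2 pol' -> cts2 g ->
  (forall s a, S s -> A a -> `|pol' s a - pol s a| <= k) ->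
  (forall s a, S s -> A a -> `|g s a| <= M) -> S s ->
  `|act_mean pol' g s - act_mean pol g s| <= k * M * integral_on A (fun=> 1).
Proof.
move=> c c' cg hk gM Ss; have cgs := cts2_slice (s := s) cg.
have cs := cts2_slice (s := s) c; have cs' := cts2_slice (s := s) c'.
rewrite /act_mean -(pfB HA); [|exact: cts_mul..].
apply: (pf_bound HA); first by apply: cts_sub; exact: cts_mul.
by move=> a Aa; rewrite -mulrBl normrM ler_pM ?hk ?gM.
Qed.

(* Insert the Bellman equation of [pol] into the return of [pol'] and telescope. *)
Lemma performance_difference_aux r pol pol' : cts2 r -> is_policy pol -> is_policy pol' ->
  J0 S A p d0 r gamma pol' =
  integral_on S (fun s => d0 s * act_mean pol (Qfun S A p r gamma pol) s) +
  dsum gamma (fun t => state_mean pol' t (fun s =>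
    act_mean pol' (Qfun S A p r gamma pol) s - act_mean pol (Qfun S A p r gamma pol) s)).
Proof.
move=> cr P P'; set Q := Qfun S A p r gamma pol; set V := act_mean pol Q.
have cpol : cts2 pol by case: P => c _ _; exact: c.
have cpol' : cts2 pol' by case: P' => c _ _; exact: c.
have cQ : cts2 Q by exact: Qfun_cts.
have cV : continuous V by exact: act_mean_cts.
have cV' : continuous (act_mean pol' Q) by exact: act_mean_cts.
have cPV : cts2 (next_mean V) by exact: next_mean_cts.
have cPV' : continuous (act_mean pol' (next_mean V)) by exact: act_mean_cts.
have cB : continuous (fun s => act_mean pol' Q s - V s) by exact: cts_sub.
have [K K0 VK] := compact_norm_bound (pf_compact HS) cV.
have [K' K'0 BK'] := compact_norm_bound (pf_compact HS) cB.
pose b t := state_mean pol' t V.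
have bK t : `|b t| <= K by exact: state_mean_bound.
have rE t : state_mean pol' t (act_mean pol' r) =
    state_mean pol' t (fun s => act_mean pol' Q s - V s) + (b t - gamma * b t.+1).
  rewrite /b (state_mean_step P')//.
  rewrite (@state_mean_ext pol' t (act_mean pol' r) (fun s =>
     - gamma * act_mean pol' (next_mean V) s + (1 * V s + (act_mean pol' Q s - V s)))).
    rewrite (state_mean_lin P')//; last first.
      by apply: cts_add => //; apply: cts_mul => //; exact: cts_cst.
    by rewrite (state_mean_lin P')// mul1r mulNr; ring.
  move=> s Ss; have cps := cts2_slice (s := s) cpol'.
  have -> : - gamma * act_mean pol' (next_mean V) s +
      (1 * V s + (act_mean pol' Q s - V s)) =
      - gamma * act_mean pol' (next_mean V) s + act_mean pol' Q s by ring.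
  rewrite /act_mean -(pf_lin HA); [|apply: cts_mul => //; exact: cts2_slice..].
  apply: (pf_ext HA) => a Aa; rewrite [Q s a]Qfun_bellman// -/Q -/V; ring.
rewrite /J0 -/(dsum gamma (fun t => state_mean pol' t (act_mean pol' r))).
under [in LHS]eq_fun do rewrite rE.
rewrite (@dsumD _ _ gamma01 (K' + (K + K)) _ (fun t => b t - gamma * b t.+1)).
- by rewrite (dsum_telescope gamma01 bK) addrC.
- move=> t; apply: (@le_trans _ _ K'); first exact: state_mean_bound.
  by rewrite lerDl addr_ge0.
- move=> t; apply: (le_trans (ler_normB _ _)).
  apply: (@le_trans _ _ (K + K)); last by rewrite lerDr.
  rewrite lerD// normrM; case/andP: gamma01 => g0 g1; rewrite ger0_norm//.
  by rewrite (le_trans _ (bK t.+1))// ler_piMl// ltW.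
Qed.

(** Subtracts two instances of the auxiliary formula: they share the initial term, and for [pol]
    against itself every gap is 0. *)
Lemma performance_difference r pol pol' : cts2 r -> is_policy pol -> is_policy pol' ->
  J0 S A p d0 r gamma pol' - J0 S A p d0 r gamma pol =
  dsum gamma (fun t => state_mean pol' t (fun s =>
    act_mean pol' (Qfun S A p r gamma pol) s - act_mean pol (Qfun S A p r gamma pol) s)).
Proof.
move=> cr P P'.
rewrite (performance_difference_aux cr P P') (performance_difference_aux cr P P).
set X := integral_on _ _; set Y := dsum _ _; set Z := dsum _ _.
suff -> : Z = 0 by rewrite addr0 addrC addKr.
(* The form [0 * 0] lets [dsumZ], with factor 0, evaluate the null series. *)
have z0 t : state_mean pol t (fun s => act_mean pol (Qfun S A p r gamma pol) s -
    act_mean pol (Qfun S A p r gamma pol) s) = 0 * 0.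
  rewrite mul0r /state_mean -[RHS](pf0 HS); apply: (pf_ext HS) => s _.
  by rewrite subrr mulr0.
rewrite /Z; under eq_fun do rewrite z0.
by rewrite (@dsumZ _ _ gamma01 0) ?mul0r// => t; rewrite normr0.
Qed.

(* The performance difference lemma again, now with the state-only reward [g]. *)
Lemma occupancy_dist pol pol' (g : 'rV[R]_n -> R) (k M : R) : continuous g ->
  is_policy pol -> is_policy pol' ->
  (forall s a, S s -> A a -> `|pol' s a - pol s a| <= k) ->
  (forall s, S s -> `|g s| <= M) ->
  `|dsum gamma (fun t => state_mean pol' t g) - dsum gamma (fun t => state_mean pol t g)|
   <= k * (M / (1 - gamma)) * integral_on A (fun=> 1) / (1 - gamma).
Proof.
move=> cg P P' hk gM; pose r (s : 'rV[R]_n) (a : 'rV[R]_m) := g s.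
have cr : cts2 r by exact: (cts_comp (cts_fst (@cts_id _)) cg).
have E pol0 : is_policy pol0 ->
    dsum gamma (fun t => state_mean pol0 t g) = J0 S A p d0 r gamma pol0.
  move=> P0; congr rseries; apply/funext => t; congr (_ * _).
  by apply: (pf_ext HS) => s Ss; rewrite -[in LHS](act_mean_cst P0 g Ss).
rewrite !E// performance_difference//.
have cpol : cts2 pol by case: P => c _ _; exact: c.
have cpol' : cts2 pol' by case: P' => c _ _; exact: c.
have cQ : cts2 (Qfun S A p r gamma pol) by exact: Qfun_cts.
apply: (dsum_bound gamma01) => t; apply: state_mean_bound => //.
  by apply: cts_sub; exact: act_mean_cts.
move=> s Ss; apply: act_mean_dist => // s' a Ss' Aa.
by apply: Qfun_bound => // s'' a'' Ss'' Aa''; exact: gM.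
Qed.

End policy_evaluation.

Lemma ler_norm_close (R : realType) (a b c K : R) :
  `|a - b| <= c -> `|a| <= K -> `|b| <= K + c.
Proof.
rewrite !ler_norml => /andP[? ?] /andP[? ?].
by apply/andP; split; lra.
Qed.

Section is_diff_pointwise.
Variables (R : realType) (V : normedModType R).
Implicit Types f g df dg : V -> R.

Lemma is_diff_addf f g df dg x : is_diff x f df -> is_diff x g dg ->
  is_diff x (fun y => f y + g y) (fun v => df v + dg v).
Proof. by move=> hf hg; exact: (is_diffD hf hg). Qed.

Lemma is_diff_mulf f g df dg x : is_diff x f df -> is_diff x g dg ->
  is_diff x (fun y => f y * g y) (fun v => f x * dg v + g x * df v).
Proof. by move=> hf hg; exact: (is_diffM hf hg). Qed.

Lemma is_diff_mulfl (c : R) f df x : is_diff x f df ->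
  is_diff x (fun y => c * f y) (fun v => c * df v).
Proof. by move=> hf; exact: (is_diffZ c hf). Qed.

Lemma is_diff_sumf N (f df : 'I_N -> V -> R) x :
  (forall k, is_diff x (f k) (df k)) ->
  is_diff x (fun y => \sum_k f k y) (fun v => \sum_k df k v).
Proof.
elim: N f df => [|N IH] f df hf.
  have E (h : 'I_0 -> V -> R) : (fun y => \sum_k h k y) = cst 0.
    by apply/funext => y; rewrite big_ord0.
  by rewrite !E; exact: is_diff_cst.
have E (h : 'I_N.+1 -> V -> R) : (fun y => \sum_k h k y) =
    (fun y => h ord0 y + \sum_k h (lift ord0 k) y).
  by apply/funext => y; rewrite big_ord_recl.
by rewrite !E; exact: is_diff_addf.
Qed.

Lemma is_diff_ln f df x : is_diff x f df -> 0 < f x ->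
  is_diff x (fun y => ln (f y)) (fun v => (f x)^-1 * df v).
Proof.
move=> hf fx0.
have dl : is_derive (f x) 1 (@ln R) (f x)^-1 by exact: is_derive1_ln.
have dln : differentiable (@ln R) (f x) by apply/derivable1_diffP; exact: ex_derive.
have := @is_diff_comp _ _ _ _ _ _ _ _ _ hf (differentiableP dln).
move=> /is_diff_eq; apply; apply/funext => v /=.
rewrite deriv1E; last exact: ex_derive.
by rewrite derive1E derive_val mulrC.
Qed.

(** A negative slope along [w] would push [f] below its minimum at some [x + t *: w]; opposite
    directions together force the slope to be 0. *)
Lemma diff_at_min f x v : differentiable f x -> (forall y, f x <= f y) -> 'd f x v = 0.
Proof.
move=> df fmin.
suff ge0 w : 0 <= 'd f x w.
  by apply/eqP; rewrite eq_le ge0 andbT -oppr_ge0 -linearN ge0.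
rewrite leNgt; apply/negP => dw.
have w1 : 0 < `|w| + 1 by rewrite ltr_wpDl.
(* Chosen so that the error [e * |w|] stays below half the supposed descent. *)
pose e := - 'd f x w / (2 * (`|w| + 1)).
have e0 : 0 < e by rewrite divr_gt0 ?oppr_gt0// mulr_gt0.
have /nbhs_ballP[r /= r0 hr] := differentiable_eps df e0.
pose t := r / (2 * (`|w| + 1)).
have t0 : 0 < t by rewrite divr_gt0// mulr_gt0.
have tw : ball 0 r (t *: w).
  rewrite -ball_normE/= sub0r normrN normrZ gtr0_norm//.
  rewrite /t mulrAC ltr_pdivrMr ?mulr_gt0// ltr_pM2l//; have := normr_ge0 w; lra.
have := hr _ tw; rewrite linearZ/= normrZ gtr0_norm// ler_norml => /andP[_].
have := fmin (x + t *: w); rewrite -[t *: 'd f x w]/(t * 'd f x w).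
set fx := f x; set fy := f _ => fxy h.
have h1 : t * - 'd f x w <= t * (e * `|w|) by rewrite mulrCA; lra.
have {h1}h2 : - 'd f x w <= e * `|w| by rewrite -(ler_pM2l t0).
have eE : e * (2 * (`|w| + 1)) = - 'd f x w.
  by rewrite /e divfK// mulf_neq0// gt_eqF.
have ew : 0 <= e * `|w| by rewrite mulr_ge0// ltW.
have : e * (2 * (`|w| + 1)) = 2 * (e * `|w|) + 2 * e by ring.
lra.
Qed.

End is_diff_pointwise.

Section partial_differentials3.
Variables (R : realType) (A B C W : normedModType R).

Lemma diff_mid (G : A * B * C -> W) a b c : differentiable G (a, b, c) ->
  is_diff b (fun b => G (a, b, c)) (fun v => 'd G (a, b, c) (0, v, 0)).
Proof.
move=> /diff_fst[d1 e1]; have [d2 e2] := diff_snd d1.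
by split => //; rewrite e2 e1.
Qed.

Lemma diff_fst3 (G : A * B * C -> W) a b c : differentiable G (a, b, c) ->
  is_diff a (fun a => G (a, b, c)) (fun v => 'd G (a, b, c) (v, 0, 0)).
Proof.
move=> /diff_fst[d1 e1]; have [d2 e2] := diff_fst d1.
by split => //; rewrite e2 e1.
Qed.

End partial_differentials3.

Section lipschitz_under_parameter.
Variables (R : realType) (d : nat) (X : topologicalType) (D : set X).
Hypothesis cD : compact D.
Variable g : 'rV[R]_d -> X -> R.
Hypothesis dg : forall u x, differentiable (fun u => g u x) u.
Hypothesis cdg : forall v,
  continuous (fun z : 'rV[R]_d * X => 'd (fun u => g u z.2) (z.1) v).

Lemma lipschitz_compact u : exists2 C : R, 0 <= C & exists2 r : R, 0 < r &
  forall h, `|h| < r -> forall x, D x -> `|g (u + h) x - g u x| <= C * `|h|.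
Proof.
have : forall i : 'I_d, exists K : R, 0 <= K /\ forall x, D x ->
    `|'d (fun u => g u x) u (delta_mx ord0 i)| <= K.
  move=> i; have [K K0 h] := compact_norm_bound cD
    (cts_slice (u := u) (@cdg (delta_mx ord0 i))).
  by exists K; split => // x Dx; exact: h.
move=> /choice[K hK].
have unif : \forall u' \near u, forall i x, D x ->
    `|'d (fun u => g u x) u (delta_mx ord0 i) -
      'd (fun u => g u x) u' (delta_mx ord0 i)| <= 1.
  apply: (@filter_forall _ _ (fun i u' => forall x, D x ->
    `|'d (fun u => g u x) u (delta_mx ord0 i) -
      'd (fun u => g u x) u' (delta_mx ord0 i)| <= 1) (nbhs u)) => i.
  exact: (compact_near_uniform u cD (@cdg (delta_mx ord0 i)) ltr01).
have /nbhs_ballP[r /= r0 ballr] := unif.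
(* [K i] bounds the [i]-th partial derivative at [u] over [D]; nearby parameters change it by at
   most 1. *)
exists (\sum_i (K i + 1)).
  by apply: sumr_ge0 => i _; have [? _] := hK i; rewrite addr_ge0.
exists r => // h hr x Dx.
have [t /andP[t0 t1] mv] := differentiable_mean_value u h (fun y => @dg y x).
have tb : ball u r (u + t *: h).
  rewrite -ball_normE/= opprD addrA subrr sub0r normrN normrZ gtr0_norm//.
  by rewrite (le_lt_trans _ hr)// ler_piMl// ltW.
pose df i y : R := 'd (fun u => g u x) y (delta_mx ord0 i).
have -> : g (u + h) x - g u x = \sum_i h ord0 i * df i (u + t *: h).
  by apply: etrans mv _; exact: diff_coord.
apply: (le_trans (ler_norm_sum _ _ _)).
rewrite mulr_suml; apply: ler_sum => i _; rewrite normrM mulrC ler_pM//.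
  have h1 : `|df i u - df i (u + t *: h)| <= 1 by exact: ballr _ tb i x Dx.
  have h2 : `|df i u| <= K i by exact: (hK i).2.
  exact: ler_norm_close h1 h2.
exact: ler_mx_entry.
Qed.

End lipschitz_under_parameter.

(** * The policy gradient *)

Lemma C1_continuous (R : realType) (V W : normedModType R) (g : V -> W) : C1 g -> continuous g.
Proof. by move=> [dg _] x; exact: differentiable_continuous. Qed.

(** * Differentiability of the action value in the action *)

Section Qfun_differential.
Variables (R : realType) (n m : nat).
Variables (S : set 'rV[R]_n) (A : set 'rV[R]_m).
Variable p : 'rV[R]_n -> 'rV[R]_m -> 'rV[R]_n -> R.
Variable gamma : R.
Hypothesis HS : pos_functional S (@integral_on R n S).
Hypothesis HA : pos_functional A (@integral_on R m A).
Hypothesis gamma01 : 0 <= gamma < 1.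
Hypothesis p_ge0 : forall s a s', S s -> A a -> S s' -> 0 <= p s a s'.
Hypothesis p_mass : forall s a, S s -> A a -> integral_on S (p s a) = 1.
Variable r : 'rV[R]_n -> 'rV[R]_m -> R.
Let pp (x : 'rV[R]_n * 'rV[R]_m * 'rV[R]_n) := p x.1.1 x.1.2 x.2.
Let rr (x : 'rV[R]_n * 'rV[R]_m) := r x.1 x.2.
Hypothesis C1p : C1 pp.
Hypothesis C1r : C1 rr.
Variable pol : 'rV[R]_n -> 'rV[R]_m -> R.
Hypothesis polP : is_policy S A pol.

Let cp : continuous pp. Proof. exact: C1_continuous. Qed.
Let cr : cts2 r. Proof. exact: C1_continuous C1r. Qed.

Let Q := Qfun S A p r gamma pol.
Let V := act_mean A pol Q.

Let cQ : cts2 Q. Proof. exact: Qfun_cts. Qed.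
Let cV : continuous V.
Proof. by apply: act_mean_cts => //; case: polP => c _ _; exact: c. Qed.

(** In the Bellman equation the action enters through [r] and [p] alone; the state value [V] is a
    continuous weight that does not depend on it. *)
Lemma Qfun_is_diff s a : is_diff a (Q s) (fun v => 'd rr (s, a) (0, v) +
  gamma * integral_on S (fun s' => V s' * 'd pp (s, a, s') (0, v, 0))).
Proof.
have [dpp cdpp] := C1p; have [drr _] := C1r.
pose g a s' := V s' * p s a s'.
have gd b s' : is_diff b (g ^~ s') (fun v => V s' * 'd pp (s, b, s') (0, v, 0)).
  by apply: is_diff_mulfl; exact: (@diff_mid _ _ _ _ _ pp s b s' (dpp _)).
have c1 := cts_fst (@cts_id ('rV[R]_m * 'rV[R]_n)%type).
have c2 := cts_snd (@cts_id ('rV[R]_m * 'rV[R]_n)%type).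
have cs : continuous (fun _ : 'rV[R]_m * 'rV[R]_n => s) by exact: cst_continuous.
have c3 := cts_pair (cts_pair cs c1) c2.
have cg : continuous (fun z : 'rV[R]_m * 'rV[R]_n => g z.1 z.2).
  by apply: cts_mul; [exact: (cts_comp c2 cV)|exact: (cts_comp c3 cp)].
have cdg v : continuous (fun z : 'rV[R]_m * 'rV[R]_n => 'd (g ^~ z.2) (z.1) v).
  have -> : (fun z : 'rV[R]_m * 'rV[R]_n => 'd (g ^~ z.2) (z.1) v) =
      (fun z => V z.2 * 'd pp (s, z.1, z.2) (0, v, 0)).
    by apply/funext => z; have [_ ->] := gd z.1 z.2.
  by apply: cts_mul; [exact: (cts_comp c2 cV)|exact: (cts_comp c3 (cdpp _))].
have [dI dIE] := diff_pf HS (fun b s' => @ex_diff _ _ _ _ _ _ _ (gd b s')) cg cdg a.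
have iI : is_diff a (fun b => integral_on S (g b))
    (fun v => integral_on S (fun s' => V s' * 'd pp (s, a, s') (0, v, 0))).
  split => //; apply/funext => v; rewrite dIE.
  by apply: (pf_ext HS) => s' _; have [_ ->] := gd a s'.
have -> : Q s = fun b => r s b + gamma * integral_on S (g b).
  apply/funext => b; rewrite /Q (Qfun_bellman HS HA gamma01 p_ge0 p_mass cp polP cr).
  congr (_ + _ * _); apply: (pf_ext HS) => s' _; exact: mulrC.
exact: (is_diff_addf (@diff_snd _ _ _ _ rr s a (drr _)) (is_diff_mulfl gamma iI)).
Qed.

Lemma diff_Qfun_cts v :
  continuous (fun z : 'rV[R]_n * 'rV[R]_m => 'd (Q z.1) (z.2) v).
Proof.
have [dpp cdpp] := C1p; have [_ cdrr] := C1r.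
have -> : (fun z : 'rV[R]_n * 'rV[R]_m => 'd (Q z.1) (z.2) v) =
    (fun z => 'd rr z (0, v) +
       gamma * integral_on S (fun s' => V s' * 'd pp (z, s') (0, v, 0))).
  by apply/funext => -[s a]; have [_ ->] := Qfun_is_diff s a.
apply: cts_add; first exact: cdrr.
apply: cts_mul; first exact: cts_cst.
have ck : continuous (fun z : 'rV[R]_n * 'rV[R]_m * 'rV[R]_n =>
    V z.2 * 'd pp (z.1, z.2) (0, v, 0)).
  apply: cts_mul; first exact: (cts_comp (cts_snd (@cts_id _)) cV).
  exact: (cts_comp (cts_pair (cts_fst (@cts_id _)) (cts_snd (@cts_id _))) (cdpp _)).
exact: (pf_continuous HS ck).
Qed.

End Qfun_differential.

Lemma integral_on0 (R : realType) (n : nat) (g : 'rV[R]_n -> R) :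
  integral_on set0 g = 0.
Proof.
have iint0 k : iint (fun _ : 'rV[R]_k => 0) = 0.
  by elim: k => [//|k IH] /=; rewrite IH Rintegral_cst// mul0r.
rewrite /integral_on -[RHS](iint0 n); congr iint.
by apply/funext => x; rewrite indicE in_set0 mul0r.
Qed.

(** Supplies the nonemptiness that the infimum defining the distance to [D] requires. *)
Lemma integral_on_neq0 (R : realType) (n : nat) (D : set 'rV[R]_n) g :
  integral_on D g = 1 -> D !=set0.
Proof.
move=> D1; apply/set0P/eqP => D0; move: D1; rewrite D0 integral_on0.
by move/esym/eqP; rewrite oner_eq0.
Qed.

(** * The gradient for mixture policies *)

Section mixture_policy_gradient.
Variables (R : realType) (n m l d N : nat).
Variables (S : set 'rV[R]_n) (A : set 'rV[R]_m) (E : set 'rV[R]_l) (gamma : R).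
Variable p : 'rV[R]_n -> 'rV[R]_m -> 'rV[R]_n -> R.
Variable d0 : 'rV[R]_n -> R.
Variable r : 'rV[R]_n -> 'rV[R]_m -> R.
Variable piw : 'rV[R]_d -> 'rV[R]_n -> 'I_N -> R.
Variable pic : 'rV[R]_d -> 'rV[R]_n -> 'I_N -> 'rV[R]_m -> R.
Variable peps : 'rV[R]_l -> R.
Variable f : 'rV[R]_d -> 'rV[R]_l -> 'rV[R]_n -> 'I_N -> 'rV[R]_m.
Hypothesis HS : pos_functional S (@integral_on R n S).
Hypothesis HA : pos_functional A (@integral_on R m A).
Hypothesis HE : pos_functional E (@integral_on R l E).
Hypothesis gamma01 : 0 <= gamma < 1.
Hypothesis p_ge0 : forall s a s', S s -> A a -> S s' -> 0 <= p s a s'.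
Hypothesis p_mass : forall s a, S s -> A a -> integral_on S (p s a) = 1.
Hypothesis d0_ge0 : forall s, S s -> 0 <= d0 s.
Hypothesis d0_mass : integral_on S d0 = 1.
Hypothesis piwP : forall theta s, S s ->
  (forall k, 0 <= piw theta s k) /\ \sum_(k < N) piw theta s k = 1.
Hypothesis picP : forall theta s k, S s ->
  (forall a, A a -> 0 <= pic theta s k a) /\ integral_on A (pic theta s k) = 1.
Hypothesis reparam : forall theta s k, S s -> forall g : 'rV[R]_m -> R, continuous g ->
  integral_on E (fun e => peps e * g (f theta e s k)) =
  integral_on A (fun a => pic theta s k a * g a).
Let pp (x : 'rV[R]_n * 'rV[R]_m * 'rV[R]_n) := p x.1.1 x.1.2 x.2.
Let rr (x : 'rV[R]_n * 'rV[R]_m) := r x.1 x.2.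
Let ff k (x : 'rV[R]_d * 'rV[R]_l * 'rV[R]_n) := f x.1.1 x.1.2 x.2 k.
Let ww k (x : 'rV[R]_d * 'rV[R]_n) := piw x.1 x.2 k.
Hypothesis C1p : C1 pp.
Hypothesis C1d0 : C1 d0.
Hypothesis C1r : C1 rr.
Hypothesis C1f : forall k, C1 (ff k).
Hypothesis C1w : forall k, C1 (ww k).
Hypothesis C1c : forall k,
  C1 (fun x : 'rV[R]_d * 'rV[R]_n * 'rV[R]_m => pic x.1.1 x.1.2 k x.2).
Hypothesis C1e : C1 peps.

Let cp : continuous pp. Proof. exact: C1_continuous. Qed.
Let cr : cts2 r. Proof. exact: C1_continuous C1r. Qed.
Let cd0 : continuous d0. Proof. exact: C1_continuous. Qed.
Let cpeps : continuous peps. Proof. exact: C1_continuous. Qed.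
Let cf k : continuous (ff k). Proof. exact: C1_continuous. Qed.
Let cw k : continuous (ww k). Proof. exact: C1_continuous. Qed.
Let cc k : continuous (fun x : 'rV[R]_d * 'rV[R]_n * 'rV[R]_m => pic x.1.1 x.1.2 k x.2).
Proof. exact: C1_continuous (C1c k). Qed.

Let pol th := mix_pol piw pic th.

Let cpol3 : continuous (fun z : 'rV[R]_d * ('rV[R]_n * 'rV[R]_m) => pol z.1 z.2.1 z.2.2).
Proof.
have cid := @cts_id ('rV[R]_d * ('rV[R]_n * 'rV[R]_m))%type.
have c1 := cts_fst cid; have c2 := cts_fst (cts_snd cid).
have c3 := cts_snd (cts_snd cid).
apply: cts_sum => k; apply: cts_mul; first exact: (cts_comp (cts_pair c1 c2) (@cw k)).
exact: (cts_comp (cts_pair (cts_pair c1 c2) c3) (@cc k)).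
Qed.

Lemma mix_pol_is_policy th : is_policy S A (pol th).
Proof.
have c3 : cts2 (pol th) by exact: (cts_slice (u := th) cpol3).
split => //.
  move=> s a Ss Aa; apply: sumr_ge0 => k _; rewrite mulr_ge0//.
    by have [+ _] := piwP th Ss; exact.
  by have [+ _] := picP th k Ss; exact.
move=> s Ss; rewrite /pol /mix_pol.
have ck k : continuous (pic th s k).
  by have := cts_slice (u := (th, s)) (@cc k); apply.
rewrite (pf_sum HA); last by move=> k; apply: cts_mul => //; exact: cts_cst.
have [_ <-] := piwP th Ss; apply: eq_bigr => k _.
by rewrite (pfZ HA)//; have [_ ->] := picP th k Ss; rewrite mulr1.
Qed.

Variable theta : 'rV[R]_d.
Let polP := mix_pol_is_policy theta.
Let Q := Qfun S A p r gamma (pol theta).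
Let dpi := occupancy S A p d0 gamma (pol theta).

Let cQ : cts2 Q. Proof. exact: Qfun_cts. Qed.
Let cdpi : continuous dpi. Proof. exact: occupancy_cts. Qed.
Let dQ s a : differentiable (Q s) a.
Proof. by have [] := Qfun_is_diff HS HA gamma01 p_ge0 p_mass C1p C1r polP s a. Qed.
Let cdQ v : continuous (fun z : 'rV[R]_n * 'rV[R]_m => 'd (Q z.1) (z.2) v).
Proof. exact: (diff_Qfun_cts HS HA gamma01 p_ge0 p_mass C1p C1r polP). Qed.

(** The reparameterized integrand of component [k]: apart from the weight, [th] acts through the
    argument of [Q], and [Q] itself is frozen at [theta]. *)
Let psi k th (x : 'rV[R]_n * 'rV[R]_l) : R :=
  peps x.2 * (piw th x.1 k * Q x.1 (f th x.2 x.1 k)).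

Let dQf k th (x : 'rV[R]_n * 'rV[R]_l) v : R :=
  'd (Q x.1) (f th x.2 x.1 k) ('d (ff k) (th, x.2, x.1) (v, 0, 0)).

Let dpsi k th (x : 'rV[R]_n * 'rV[R]_l) v : R := peps x.2 *
  (piw th x.1 k * dQf k th x v + Q x.1 (f th x.2 x.1 k) * 'd (ww k) (th, x.1) (v, 0)).

Let is_diff_f k th e s : is_diff th (fun th => f th e s k)
  (fun v => 'd (ff k) (th, e, s) (v, 0, 0)).
Proof. exact: (@diff_fst3 _ _ _ _ _ (ff k) th e s ((C1f k).1 _)). Qed.

Let is_diff_piw k th s : is_diff th (fun th => piw th s k)
  (fun v => 'd (ww k) (th, s) (v, 0)).
Proof. exact: (@diff_fst _ _ _ _ (ww k) th s ((C1w k).1 _)). Qed.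

Let is_diff_psi k th x : is_diff th (fun th => psi k th x) (dpsi k th x).
Proof.
have iQ : is_diff th (fun th => Q x.1 (f th x.2 x.1 k)) (dQf k th x).
  exact: (@is_diff_comp _ _ _ _ (fun th => f th x.2 x.1 k) _ (Q x.1) _ th
    (is_diff_f k th x.2 x.1) (differentiableP (@dQ _ _))).
exact: (is_diff_mulfl (peps x.2) (is_diff_mulf (is_diff_piw k th x.1) iQ)).
Qed.

Let X := ('rV[R]_d * ('rV[R]_n * 'rV[R]_l))%type.
Let cth : continuous (fun z : X => z.1). Proof. exact: cts_fst (@cts_id _). Qed.
Let cst : continuous (fun z : X => z.2.1).
Proof. exact: cts_fst (cts_snd (@cts_id _)). Qed.
Let cep : continuous (fun z : X => z.2.2).
Proof. exact: cts_snd (cts_snd (@cts_id _)). Qed.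

Let cfX k : continuous (fun z : X => f z.1 z.2.2 z.2.1 k).
Proof. exact: (cts_comp (cts_pair (cts_pair cth cep) cst) (@cf k)). Qed.

Let cQX k : continuous (fun z : X => Q z.2.1 (f z.1 z.2.2 z.2.1 k)).
Proof. exact: (cts_comp (cts_pair cst (@cfX k)) cQ). Qed.

Let cwX k : continuous (fun z : X => piw z.1 z.2.1 k).
Proof. exact: (cts_comp (cts_pair cth cst) (@cw k)). Qed.

Let cpepsX : continuous (fun z : X => peps z.2.2).
Proof. exact: (cts_comp cep cpeps). Qed.

Let cpsi k : continuous (fun z : X => psi k z.1 z.2).
Proof. by apply: cts_mul => //; exact: cts_mul. Qed.

Let cdQf k v : continuous (fun z : X => dQf k z.1 z.2 v).
Proof.
pose w (z : X) := 'd (ff k) (z.1, z.2.2, z.2.1) (v, 0, 0).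
have cwz : continuous w.
  exact: (cts_comp (cts_pair (cts_pair cth cep) cst) ((C1f k).2 (v, 0, 0))).
(* The direction fed to the differential of [Q] moves with [z], while continuity is known for fixed
   directions; hence the coordinates. *)
have -> : (fun z : X => dQf k z.1 z.2 v) = (fun z => \sum_(i < m)
    w z ord0 i * 'd (Q z.2.1) (f z.1 z.2.2 z.2.1 k) (delta_mx ord0 i)).
  by apply/funext => z; exact: diff_coord.
apply: cts_sum => i; apply: cts_mul.
  exact: (cts_comp cwz (@coord_continuous _ _ _ ord0 i)).
exact: (cts_comp (cts_pair cst (@cfX k)) (@cdQ (delta_mx ord0 i))).
Qed.

Let cdpsi k v : continuous (fun z : X => dpsi k z.1 z.2 v).
Proof.
apply: cts_mul => //; apply: cts_add; apply: cts_mul => //.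
exact: (cts_comp (cts_pair cth cst) ((C1w k).2 (v, 0))).
Qed.

Let act_mean_reparam th s : S s ->
  act_mean A (pol th) Q s = \sum_k integral_on E (fun e => psi k th (s, e)).
Proof.
move=> Ss; have cQs := cts2_slice (s := s) cQ.
have ck k : continuous (pic th s k).
  by have := cts_slice (u := (th, s)) (@cc k); apply.
have ce k : continuous (fun e => f th e s k).
  apply: (@cts_comp _ _ _ (fun e => ((th, (s, e)) : X)) _ _ (@cfX k)).
  apply: cts_pair; first exact: cst_continuous.
  by apply: cts_pair; [exact: cst_continuous|exact: cts_id].
transitivity (integral_on A (fun a => \sum_k piw th s k * (pic th s k a * Q s a))).
  apply: (pf_ext HA) => a _; rewrite mulr_suml.
  by apply: eq_bigr => k _; rewrite mulrA.
rewrite (pf_sum HA); last first.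
  by move=> k; apply: cts_mul; [exact: cts_cst|exact: cts_mul].
apply: eq_bigr => k _; rewrite (pfZ HA); last exact: cts_mul.
rewrite -(reparam th k Ss cQs) -(pfZ HE).
  by apply: (pf_ext HE) => e _; rewrite mulrCA.
by apply: cts_mul => //; exact: (cts_comp (@ce k) cQs).
Qed.

Let ISE (g : 'rV[R]_n * 'rV[R]_l -> R) :=
  integral_on S (fun s => integral_on E (fun e => g (s, e))).
Let HSE : pos_functional (S `*` E) ISE. Proof. exact: pf_prod HS HE. Qed.

Let phi k th x := dpi x.1 * psi k th x.

Let is_diff_phi k th x : is_diff th (fun th => phi k th x) (fun v => dpi x.1 * dpsi k th x v).
Proof. exact: (is_diff_mulfl (dpi x.1) (is_diff_psi k th x)). Qed.

Let cdpiX : continuous (fun z : X => dpi z.2.1).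
Proof. exact: (cts_comp cst cdpi). Qed.

Let cphi k : continuous (fun z : X => phi k z.1 z.2). Proof. exact: cts_mul. Qed.

Let cdphi k v : continuous (fun z : X => 'd (fun th => phi k th z.2) (z.1) v).
Proof.
have -> : (fun z : X => 'd (fun th => phi k th z.2) (z.1) v) =
    (fun z => dpi z.2.1 * dpsi k z.1 z.2 v).
  by apply/funext => z; have [_ ->] := is_diff_phi k z.1 z.2.
exact: cts_mul.
Qed.

Let H th := \sum_k ISE (phi k th).

Let HE' th : H th = integral_on S (fun s => dpi s * act_mean A (pol th) Q s).
Proof.
have ck k : continuous (fun s => integral_on E (fun e => phi k th (s, e))).
  exact: (pf_continuous HE (cts_slice (u := th) (@cphi k))).
rewrite /H /ISE -(pf_sum HS)//; apply: (pf_ext HS) => s Ss.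
rewrite act_mean_reparam// mulr_sumr; apply: eq_bigr => k _.
rewrite -(pfZ HE)//; have := cts_slice (u := s) (cts_slice (u := th) (@cpsi k)).
exact.
Qed.

Let is_diff_H : is_diff theta H
  (fun v => \sum_k ISE (fun x => dpi x.1 * dpsi k theta x v)).
Proof.
apply: is_diff_sumf => k.
have [dI dIE] := diff_pf HSE (fun th x => @ex_diff _ _ _ _ _ _ _ (is_diff_phi k th x))
  (@cphi k) (@cdphi k) theta.
split => //; apply/funext => v; rewrite dIE; congr ISE.
by apply/funext => x; have [_ ->] := is_diff_phi k theta x.
Qed.

Let J th := J0 S A p d0 r gamma (pol th).

Let gap th s := act_mean A (pol th) Q s - act_mean A (pol theta) Q s.

(** Both increments average the same [gap], under the state laws of [th] for [J] and of [theta] for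
    [H], so only the change of law remains. *)
Let Jdiff th : J th - J theta - (H th - H theta) =
  dsum gamma (fun t => state_mean S A p d0 (pol th) t (gap th)) -
  dsum gamma (fun t => state_mean S A p d0 (pol theta) t (gap th)).
Proof.
have P' := mix_pol_is_policy th.
have cV th' : continuous (act_mean A (pol th') Q).
  by apply: act_mean_cts => //; case: (mix_pol_is_policy th') => c _ _; exact: c.
have cg : continuous (gap th) by exact: cts_sub.
congr (_ - _).
  exact: (performance_difference HS HA gamma01 p_ge0 p_mass d0_ge0 d0_mass cp cd0 cr polP P').
rewrite -(occupancy_mean HS HA gamma01 p_ge0 p_mass d0_ge0 d0_mass cp cd0 polP cg).
rewrite !HE' -(pfB HS); [|exact: cts_mul..].
by apply: (pf_ext HS) => s _; rewrite -mulrBr.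
Qed.

(** Read in reparameterized form, the average inherits a Lipschitz bound from each [psi k] over the
    compact [S] times [E]; over the components, constants add and radii take their minimum. *)
Let act_mean_lipschitz : exists2 C : R, 0 <= C & exists2 rho : R, 0 < rho &
  forall h, `|h| < rho -> forall s, S s ->
  `|act_mean A (pol (theta + h)) Q s - act_mean A (pol theta) Q s| <= C * `|h|.
Proof.
have cD := compact_setX (pf_compact HS) (pf_compact HE).
have cdps k v : continuous (fun z : X => 'd (fun th => psi k th z.2) (z.1) v).
  have -> : (fun z : X => 'd (fun th => psi k th z.2) (z.1) v) =
      (fun z => dpsi k z.1 z.2 v).
    by apply/funext => z; have [_ ->] := is_diff_psi k z.1 z.2.
  exact: cdpsi.
have : forall k : 'I_N, exists c : R * R, [/\ 0 <= c.1, 0 < c.2 & forall h, `|h| < c.2 ->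
    forall x, (S `*` E) x -> `|psi k (theta + h) x - psi k theta x| <= c.1 * `|h|].
  move=> k; have [C C0 [rho rho0 hC]] := lipschitz_compact cD
    (fun th x => @ex_diff _ _ _ _ _ _ _ (is_diff_psi k th x)) (cdps k) theta.
  by exists (C, rho).
move=> /choice[c hc].
set mE := integral_on E (fun=> 1); have mE0 : 0 <= mE by exact: pf_mass_ge0 HE.
exists (\sum_k (c k).1 * mE).
  by apply: sumr_ge0 => k _; have [? _ _] := hc k; rewrite mulr_ge0.
exists (\big[Num.min/1]_k (c k).2).
  by apply/bigmin_gtP; split => // k _; have [] := hc k.
move=> h hh s Ss; rewrite !act_mean_reparam// -sumrB.
apply: (le_trans (ler_norm_sum _ _ _)); rewrite mulr_suml; apply: ler_sum => k _.
have [c0 _ hk] := hc k.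
have cps th : continuous (fun e => psi k th (s, e)).
  by have := cts_slice (u := s) (cts_slice (u := th) (@cpsi k)); apply.
rewrite -(pfB HE)// mulrAC; apply: (pf_bound HE); first exact: cts_sub.
move=> e Ee; apply: hk => //; apply: (lt_le_trans hh).
exact: bigmin_le_cond.
Qed.

Let J_perturb (e : R) : 0 < e -> exists2 rho : R, 0 < rho & forall h, `|h| < rho ->
  `|J (theta + h) - J theta - (H (theta + h) - H theta)| <= e * `|h|.
Proof.
move=> e0; have [C C0 [rho rho0 hC]] := act_mean_lipschitz.
set mA := integral_on A (fun=> 1); have mA0 : 0 <= mA by exact: pf_mass_ge0 HA.
have og0 : 0 < 1 - gamma by rewrite subr_gt0; case/andP: gamma01.
(* The constant of [occupancy_dist] for a reward of size [C * |h|]: one factor [1 / (1 - gamma)]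
   bounds its action value, the other sums over time. Below, [k] is the policy distance that makes
   [k * K] at most [e]. *)
pose K := C / (1 - gamma) * mA / (1 - gamma).
have K0 : 0 <= K by rewrite /K !mulr_ge0// invr_ge0 ltW.
pose k := e / (K + 1).
have k0 : 0 < k by rewrite divr_gt0// ltr_wpDl.
have /nbhs_ballP[rho' /= rho'0 hk] := compact_near_uniform theta
  (compact_setX (pf_compact HS) (pf_compact HA)) cpol3 k0.
exists (Num.min rho rho'); first by rewrite lt_min rho0.
move=> h; rewrite lt_min => /andP[h1 h2].
have hb : ball theta rho' (theta + h).
  by rewrite -ball_normE/= opprD addrA subrr sub0r normrN.
rewrite Jdiff.
have cV th' : continuous (act_mean A (pol th') Q).
  by apply: act_mean_cts => //; case: (mix_pol_is_policy th') => c _ _; exact: c.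
have cg : continuous (gap (theta + h)) by exact: cts_sub.
have pk s a : S s -> A a -> `|pol (theta + h) s a - pol theta s a| <= k.
  by move=> Ss Aa; rewrite distrC; exact: (hk _ hb (s, a)).
have := occupancy_dist HS HA gamma01 p_ge0 p_mass d0_ge0 d0_mass cp cd0 cg polP
  (mix_pol_is_policy (theta + h)) pk (hC _ h1).
move/le_trans; apply.
have -> : k * (C * `|h| / (1 - gamma)) * mA / (1 - gamma) = k * K * `|h|.
  by rewrite /K; ring.
rewrite ler_wpM2r//.
have kE : k * (K + 1) = e by rewrite /k divfK// gt_eqF// ltr_wpDl.
by rewrite -kE ler_pM2l// lerDl.
Qed.

(** The log-derivative identity, weight times derivative of [ln], requires a positive weight. At
    weight 0 both sides vanish separately: the right by its factor, the left since both terms of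
    [dpsi] do. *)
Let weight_term k s v : S s ->
  integral_on E (fun e => dpsi k theta (s, e) v) =
  piw theta s k * integral_on E (fun e => peps e *
    (Q s (f theta e s k) * 'd (fun th => ln (piw th s k)) theta v
     + 'd (Q s) (f theta e s k) ('d (fun th => f th e s k) theta v))).
Proof.
move=> Ss; have [dw dwE] := is_diff_piw k theta s.
have w_ge0 th : 0 <= piw th s k by have [+ _] := piwP th Ss; exact.
have [w0|w0] := eqVneq (piw theta s k) 0.
  have dw0 : 'd (ww k) (theta, s) (v, 0) = 0.
    have := @diff_at_min _ _ (fun th => piw th s k) theta v dw.
    by rewrite dwE; apply => th; rewrite w0.
  rewrite w0 mul0r -[RHS](pf0 HE); apply: (pf_ext HE) => e _.
  by rewrite /dpsi/= w0 dw0 mulr0 mul0r addr0 mulr0.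
have wgt0 : 0 < piw theta s k by rewrite lt_neqAle eq_sym w0 w_ge0.
have [_ dlnE] := is_diff_ln (is_diff_piw k theta s) wgt0.
have sl (G : X -> R) : continuous G -> continuous (fun e => G (theta, (s, e))).
  by move=> cG; have := cts_slice (u := s) (cts_slice (u := theta) cG); apply.
rewrite dlnE -(pfZ HE); last first.
  apply: cts_mul => //; apply: cts_add.
    by apply: cts_mul; [exact: (sl _ (@cQX k))|exact: cts_cst].
  have -> : (fun e => 'd (Q s) (f theta e s k) ('d (fun th => f th e s k) theta v)) =
      (fun e => dQf k theta (s, e) v).
    by apply/funext => e; have [_ ->] := is_diff_f k theta e s.
  exact: (sl _ (@cdQf k v)).
apply: (pf_ext HE) => e _; rewrite /dpsi /dQf/=.
have [_ ->] := is_diff_f k theta e s.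
by field.
Qed.

Lemma mixture_policy_gradient : differentiable J theta /\
  forall v : 'rV[R]_d, 'd J theta v =
    integral_on S (fun s => dpi s * \sum_(k < N) piw theta s k *
      integral_on E (fun e => peps e *
        (Q s (f theta e s k) * 'd (fun th => ln (piw th s k)) theta v
         + 'd (Q s) (f theta e s k) ('d (fun th => f th e s k) theta v)))).
Proof.
have [dH dHE] := is_diff_H.
have [dJ dJE] : differentiable J theta /\ 'd J theta = 'd H theta :> ('rV[R]_d -> R).
  exact: differentiable_perturb_ball dH J_perturb.
split => // v; rewrite dJE dHE /ISE.
have cth2 k : continuous (fun x : 'rV[R]_n * 'rV[R]_l => dpi x.1 * dpsi k theta x v).
  by have := cts_slice (u := theta) (cts_mul cdpiX (@cdpsi k v)); apply.
rewrite -(pf_sum HS); last by move=> k; exact: (pf_continuous HE (@cth2 k)).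
apply: (pf_ext HS) => s Ss; rewrite mulr_sumr; apply: eq_bigr => k _.
rewrite -weight_term// -(pfZ HE)//.
by have := cts_slice (u := s) (cts_slice (u := theta) (@cdpsi k v)); apply.
Qed.

End mixture_policy_gradient.

Unset Implicit Arguments.

Theorem theoremC2 (R : realType) (n m l d N : nat)
  (S : set 'rV[R]_n) (A : set 'rV[R]_m) (E : set 'rV[R]_l) (gamma : R)
  (p : 'rV[R]_n -> 'rV[R]_m -> 'rV[R]_n -> R)
  (d0 : 'rV[R]_n -> R)
  (r : 'rV[R]_n -> 'rV[R]_m -> R)
  (piw : 'rV[R]_d -> 'rV[R]_n -> 'I_N -> R)
  (pic : 'rV[R]_d -> 'rV[R]_n -> 'I_N -> 'rV[R]_m -> R)
  (peps : 'rV[R]_l -> R)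
  (f : 'rV[R]_d -> 'rV[R]_l -> 'rV[R]_n -> 'I_N -> 'rV[R]_m)
  (finv : 'rV[R]_d -> 'rV[R]_m -> 'rV[R]_n -> 'I_N -> 'rV[R]_l) :
  (* compact state and action spaces *)
  compact S -> compact A ->
  (* discount factor *)
  0 <= gamma < 1 ->
  (* transition density on S *)
  (forall s a s', S s -> A a -> S s' -> 0 <= p s a s') ->
  (forall s a, S s -> A a -> integral_on S (p s a) = 1) ->
  (* initial state density on S *)
  (forall s, S s -> 0 <= d0 s) ->
  integral_on S d0 = 1 ->
  (* bounded deterministic reward *)
  (exists M : R, forall s a, S s -> A a -> `|r s a| <= M) ->
  (* mixture weights: a distribution on {1..N} *)
  (forall theta s, S s ->
     (forall k, 0 <= piw theta s k) /\ \sum_(k < N) piw theta s k = 1) ->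
  (* component densities on A *)
  (forall theta s k, S s ->
     (forall a, A a -> 0 <= pic theta s k a) /\
     integral_on A (pic theta s k) = 1) ->
  (* noise density *)
  (forall e, E e -> 0 <= peps e) ->
  integral_on E peps = 1 ->
  (* f(.;s,k) is invertible from the noise space onto A, inverse finv *)
  (forall theta s k e, S s -> E e -> A (f theta e s k)) ->
  (forall theta s k a, S s -> A a -> E (finv theta a s k)) ->
  (forall theta s k e, S s -> E e -> finv theta (f theta e s k) s k = e) ->
  (forall theta s k a, S s -> A a -> f theta (finv theta a s k) s k = a) ->
  (* reparameterization: f_theta(eps;s,k) ~ pi^c_theta(.|s,k) for eps ~ peps *)
  (forall theta s k, S s -> forall g : 'rV[R]_m -> R, continuous g ->
     integral_on E (fun e => peps e * g (f theta e s k)) =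
     integral_on A (fun a => pic theta s k a * g a)) ->
  (* regularity: the functions and their derivatives are continuous *)
  C1 (fun x : 'rV[R]_n * 'rV[R]_m * 'rV[R]_n => p x.1.1 x.1.2 x.2) ->
  C1 d0 ->
  C1 (fun x : 'rV[R]_n * 'rV[R]_m => r x.1 x.2) ->
  (forall k, C1 (fun x : 'rV[R]_d * 'rV[R]_l * 'rV[R]_n => f x.1.1 x.1.2 x.2 k)) ->
  (forall k, C1 (fun x : 'rV[R]_d * 'rV[R]_m * 'rV[R]_n => finv x.1.1 x.1.2 x.2 k)) ->
  (forall k, C1 (fun x : 'rV[R]_d * 'rV[R]_n => piw x.1 x.2 k)) ->
  (forall k, C1 (fun x : 'rV[R]_d * 'rV[R]_n * 'rV[R]_m => pic x.1.1 x.1.2 k x.2)) ->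
  C1 peps ->
  forall theta : 'rV[R]_d,
    let J := fun th => J0 S A p d0 r gamma (mix_pol piw pic th) in
    let Q := Qfun S A p r gamma (mix_pol piw pic theta) in
    let dpi := occupancy S A p d0 gamma (mix_pol piw pic theta) in
    differentiable J theta /\
    forall v : 'rV[R]_d,
      'd J theta v =
      integral_on S (fun s => dpi s *
        \sum_(k < N) piw theta s k *
          integral_on E (fun e => peps e *
            (Q s (f theta e s k) * 'd (fun th => ln (piw th s k)) theta v
             + 'd (Q s) (f theta e s k) ('d (fun th => f th e s k) theta v)))).
Proof.
move=> cS cA g01 p0 p1 d00 d01 _ wP cP _ e1 fA finvE fK _ rep Cp Cd0 Cr Cf Cfi Cw Cc Ce.
move=> theta J Q dpi.
have S0 := integral_on_neq0 d01; have [s0 Ss0] := S0.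
(* Weights summing to 1 force at least one component; it provides a density of mass one on [A] and
   an inverse carrying [A] onto [E]. *)
have [k0 _] : exists k : 'I_N, True.
  apply: contrapT => nk; have [_] := wP theta s0 Ss0.
  rewrite big1; first by move=> /esym/eqP; rewrite oner_eq0.
  by move=> k _; case: nk; exists k.
have A0 := integral_on_neq0 (cP theta s0 k0 Ss0).2.
have cE : compact E.
  have -> : E = (fun a => finv theta a s0 k0) @` A.
    apply/seteqP; split => [e Ee|_ [a Aa <-]]; last exact: finvE.
    by exists (f theta e s0 k0); [exact: fA|exact: fK].
  apply: continuous_compact => //; apply: continuous_subspaceT.
  have cst0 (T : topologicalType) (b : T) : continuous (fun _ : 'rV[R]_m => b).
    exact: cst_continuous.
  exact: (cts_comp (cts_pair (cts_pair (cst0 _ theta) (@cts_id _)) (cst0 _ s0))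
    (C1_continuous (Cfi k0))).
exact: (mixture_policy_gradient (pos_functional_integral_on cS S0)
  (pos_functional_integral_on cA A0) (pos_functional_integral_on cE (integral_on_neq0 e1))
  g01 p0 p1 d00 d01 wP cP rep Cp Cd0 Cr Cf Cw Cc Ce).
Qed.
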